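(* Let $N\in\{2,3,5,6,7,11,14,15,23\}$, let $k\in\mathbb Z$, and let $\chi$ be an admissible character of weight $k$ on $\Gamma_0(N)^+$. Write $k=k'+\ell\,k_1(N)$ with $k'=k'(N,\chi,k)$ and $\ell\in\mathbb Z$. Then for all integers $m,n$ for which the coefficients are defined (i.e. $m\ge-\ell$ and $n\ge\ell+1$) one has $$a_k^{(\chi)}(m,n)=-a_{2-k}^{(\chi\psi^{-2k})}(n,m).$$
   Context: $H$ is the upper half plane and $q=\exp(2\pi i\tau)$, $\tau\in H$. $\Gamma_0(N)=\{\begin{pmatrix}a&b\\ c&d\end{pmatrix}\in \mathrm{SL}_2(\mathbb Z): N\mid c\}$. For $m\mid N$, $W_m$ denotes an Atkin-Lehner matrix $\begin{pmatrix}mx&y\\ N z&mw\end{pmatrix}$ with integers $x,y,z,w$ and determinant $m$; take $W_N=\begin{pmatrix}0&-1\\ N&0\end{pmatrix}$. $\Gamma_0(N)^+\subseteq \mathrm{GL}_2(\mathbb Q)$ is the group generated by $\Gamma_0(N)$ and all $W_m$, $m\mid N$. For the listed $N$, the quotient $\Gamma_0(N)^+\backslash H$ has a single cusp and its compactification has genus $0$. For $\gamma=\begin{pmatrix}a&b\\ c&d\end{pmatrix}$ of positive determinant put $(f|_k\gamma)(\tau)=\det(\gamma)^{k/2}(c\tau+d)^{-k}f(\gamma\tau)$. An admissible character of weight $k$ is a character (group homomorphism) $\chi:\Gamma_0(N)^+\to\mathbb C^\times$ that is trivial on positive scalar matrices, satisfies $\chi(-1)=(-1)^k$, and whose restriction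 to $\Gamma_0(N)$ is a real (trivial or quadratic) character modulo $N$; for composite $N$ it is assumed that the involutions $W_m$ commute, which means that $\chi|_{\Gamma_0(N)}$ is trivial, or $N=14$ and $\chi|_{\Gamma_0(N)}$ is given by the Legendre symbol modulo $7$, or $N=15$ and it is given by the Legendre (Jacobi) symbol modulo $15$. $M_k(\Gamma_0(N)^+,\chi)$ is the space of modular forms $f$ of weight $k$ for $\Gamma_0(N)$ with character $\chi|_{\Gamma_0(N)}$ satisfying $f|_k\gamma=\chi(\gamma)f$ for all $\gamma\in\Gamma_0(N)^+$. $\mathcal M_k(\Gamma_0(N)^+,\chi)$ is the space of weakly holomorphic forms: holomorphic on $H$, meromorphic at the cusp, with the same transformation law. $\Delta_N(z)=\prod_{m\mid N}\eta(mz)^{24/\sigma_1(N)}$, where $\eta$ is the Dedekind eta function and $\sigma_1(N)=\sum_{m\mid N} m$; its weight is $k_1(N)=12\sigma_0(N)/\sigma_1(N)$, where $\sigma_0(N)$ is the number of divisors of $N$. It has a zero of order $1$ at the cusp, no zeros in $H$, and is modular for $\Gamma_0(N)^+$ with character $\psi^{k_1(N)}$, where $\psi\begin{pmatrix}a&b\\ c&d\end{pmatrix}=\left(\frac{-N}{a}\right)$ on $\Gamma_0(N)$ if $N$ is a prime congruent to $3$ modulo $4$, $\psi|_{\Gamma_0(N)}=1$ otherwise, $\psi(W_N)=i^{-1}$, $\psi(W_2)=1$ if $N\in\{6,14\}$, and $\psi(W_3)=1$ if $N=15$. (For $N\in\{2,5,6,14,15\}$, $k_1(N)$ is even and only even powers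 of $\psi$ are used; these are genuine characters of $\Gamma_0(N)^+$, trivial on $\Gamma_0(N)$ and on scalar matrices.) $k'(N,\chi,k)$ is the smallest non-negative integer $k'\equiv k\bmod k_1(N)$ with $M_{k'}(\Gamma_0(N)^+,\chi\psi^{k'-k})\neq\{0\}$. With $k=k'+\ell k_1(N)$, for each integer $m\ge-\ell$ there is a unique $f_{k,m}^{(\chi)}\in\mathcal M_k(\Gamma_0(N)^+,\chi)$ with $q$-expansion of the form $q^{-m}+O(q^{\ell+1})$, and one writes $$f_{k,m}^{(\chi)}(\tau)=q^{-m}+\sum_{n=\ell+1}^\infty a_k^{(\chi)}(m,n)q^n.$$ The coefficients $a_{2-k}^{(\chi\psi^{-2k})}(n,m)$ are defined by the same recipe with $(k,\chi)$ replaced by $(2-k,\chi\psi^{-2k})$; the integer corresponding to $\ell$ for this pair is $-1-\ell$. *)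

(* Defs.v *)
From HB Require Import structures.
From mathcomp Require Import all_boot all_order all_algebra.
From mathcomp Require Import complex.
From mathcomp Require Import all_classical all_reals all_analysis.

Set Implicit Arguments.
Unset Strict Implicit.
Unset Printing Implicit Defensive.

Import Order.TTheory GRing.Theory Num.Theory.
Import numFieldNormedType.Exports.

Local Open Scope classical_set_scope.
Local Open Scope ring_scope.
Local Open Scope complex_scope.

Definition legendre (a : int) (p : nat) : int :=
  if (p%:Z %| a)%Z then 0
  else if [exists x : 'I_p, (p%:Z %| x%:Z ^+ 2 - a)%Z] then 1 else -1.

Definition kronecker_prime (D : int) (p : nat) : int :=
  if p == 2 then
    if (2 %| D)%Z then 0
    else if ((D %% 8)%Z == 1) || ((D %% 8)%Z == 7) then 1 else -1
  else legendre D p.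

(* The Kronecker symbol (D / n); the Jacobi symbol when n is odd and positive. *)
Definition kronecker (D n : int) : int :=
  if n == 0 then (`|D| == 1)%:Z
  else (if (n < 0) && (D < 0) then -1 else 1)
       * \prod_(p <- primes `|n|%N) kronecker_prime D p ^+ logn p `|n|%N.

(* A Dirichlet character modulo N is real iff its values lie in {-1, 0, 1},
   i.e. iff it is integer-valued. *)
Definition real_dirichlet (N : nat) (e : int -> int) : Prop :=
  [/\ e 1 = 1,
      forall a b : int, e (a * b) = e a * e b,
      forall a : int, e (a + N%:Z) = e a
    & forall a : int, (e a != 0) = coprimez a N%:Z].

Definition mx2 (a b c d : int) : 'M[rat]_2 :=
  \matrix_(i < 2, j < 2)
    (if i == 0 then (if j == 0 then a else b)
               else (if j == 0 then c else d))%:~R.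

Definition Gamma0 (N : nat) (g : 'M[rat]_2) : Prop :=
  exists a b c d : int,
    [/\ g = mx2 a b c d, a * d - b * c = 1 & (N%:Z %| c)%Z].

Definition AtkinLehner (N m : nat) (g : 'M[rat]_2) : Prop :=
  exists x y z w : int,
    g = mx2 (m%:Z * x) y (N%:Z * z) (m%:Z * w)
    /\ (m%:Z * x) * (m%:Z * w) - y * (N%:Z * z) = m%:Z.

Definition Fricke (N : nat) : 'M[rat]_2 := mx2 0 (-1) N%:Z 0.

Inductive Gamma0plus (N : nat) : 'M[rat]_2 -> Prop :=
| Gamma0plus_Gamma0 g : Gamma0 N g -> Gamma0plus N g
| Gamma0plus_AL m g : (m %| N)%N -> AtkinLehner N m g -> Gamma0plus N g
| Gamma0plus_mul g h :
    Gamma0plus N g -> Gamma0plus N h -> Gamma0plus N (g *m h)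
| Gamma0plus_inv g : Gamma0plus N g -> Gamma0plus N (invmx g).

Definition sigma0 (N : nat) : nat := size (divisors N).
Definition sigma1 (N : nat) : nat := (\sum_(d <- divisors N) d)%N.

(* The division is exact for every level considered. *)
Definition k1 (N : nat) : nat := (12 * sigma0 N %/ sigma1 N)%N.

Definition levels : seq nat := [:: 2; 3; 5; 6; 7; 11; 14; 15; 23]%N.

Section Forms.
Variable R : realType.
Local Notation C := R[i].

Definition upper_half (tau : C) : Prop := 0 < complex.Im tau.

Definition cexp (z : C) : C :=
  (expR (complex.Re z))%:C * (cos (complex.Im z) +i* sin (complex.Im z)).

Definition qpar (tau : C) : C := cexp ((2 * pi)%:C * (0 +i* 1) * tau).

Definition moebius (g : 'M[rat]_2) (tau : C) : C :=
  (ratr (g 0 0) * tau + ratr (g 0 1)) / (ratr (g 1 0) * tau + ratr (g 1 1)).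

Definition slash (k : int) (f : C -> C) (g : 'M[rat]_2) (tau : C) : C :=
  ((ratr (\det g) : R) `^ (k%:~R / 2))%:C
  * (ratr (g 1 0) * tau + ratr (g 1 1)) ^ (- k) * f (moebius g tau).

(* Characters are functions on all of 'M[rat]_2, of which only the values on
   Gamma0plus N matter. *)
Definition is_character (N : nat) (chi : 'M[rat]_2 -> C) : Prop :=
  (forall g, Gamma0plus N g -> chi g != 0) /\
  (forall g h, Gamma0plus N g -> Gamma0plus N h ->
     chi (g *m h) = chi g * chi h).

Definition charM (chi psi : 'M[rat]_2 -> C) : 'M[rat]_2 -> C :=
  fun g => chi g * psi g.

Definition on_Gamma0 (N : nat) (chi : 'M[rat]_2 -> C) (e : int -> int) : Prop :=
  forall a b c d : int, a * d - b * c = 1 -> (N%:Z %| c)%Z ->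
    chi (mx2 a b c d) = (e d)%:~R.

Definition admissible (N : nat) (k : int) (chi : 'M[rat]_2 -> C) : Prop :=
  [/\ is_character N chi,
      forall r : rat, 0 < r -> Gamma0plus N r%:M -> chi r%:M = 1,
      chi (- 1%:M) = (-1) ^ k,
      exists2 e : int -> int, real_dirichlet N e & on_Gamma0 N chi e
    & ~~ prime N ->
      [\/ on_Gamma0 N chi (fun=> 1),
          N = 14%N /\ on_Gamma0 N chi (fun d => legendre d 7)
        | N = 15%N /\ on_Gamma0 N chi (fun d => kronecker d 15)]].

(* [is_psi_pow N e phi]: phi is the character psi^e of Gamma0plus N. The
   powers are specified directly because psi itself is a character only when N
   is a prime congruent to 3 modulo 4; for the other levels e must be even.
   The conditions fix phi on a set of generators of Gamma0plus N. *)
Definition is_psi_pow (N : nat) (e : int) (phi : 'M[rat]_2 -> C) : Prop :=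
  [/\ is_character N phi,
      forall a b c d : int, a * d - b * c = 1 -> (N%:Z %| c)%Z ->
        phi (mx2 a b c d) =
          (if prime N && (N %% 4 == 3)%N
           then ((kronecker (- N%:Z) a)%:~R : C) else 1) ^ e,
      phi (Fricke N) = ((0 +i* 1)^-1 : C) ^ e,
      (N = 6%N \/ N = 14%N) -> forall g, AtkinLehner N 2 g -> phi g = 1
    & N = 15%N -> forall g, AtkinLehner N 3 g -> phi g = 1].

Definition holomorphic_on_H (f : C -> C) : Prop :=
  forall tau : C, upper_half tau -> derivable (f : C^o -> C^o) tau 1.

Definition bounded_at_infty (f : C -> C) : Prop :=
  exists A B : R, 0 < A /\
    forall tau : C, A <= complex.Im tau -> `|f tau| <= B%:C.

Definition transforms (N : nat) (k : int) (chi : 'M[rat]_2 -> C)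
    (f : C -> C) : Prop :=
  forall g, Gamma0plus N g -> forall tau, upper_half tau ->
    slash k f g tau = chi g * f tau.

(* M_k(Gamma0plus N, chi); the last condition is holomorphy at all the cusps of
   Gamma0 N. *)
Definition modular_form (N : nat) (k : int) (chi : 'M[rat]_2 -> C)
    (f : C -> C) : Prop :=
  [/\ holomorphic_on_H f, transforms N k chi f
    & forall g, Gamma0 1 g -> bounded_at_infty (slash k f g)].

(* Gamma0plus N has a single cusp for the levels considered, so that
   meromorphy is required at infinity only. *)
Definition weakly_holomorphic_form (N : nat) (k : int) (chi : 'M[rat]_2 -> C)
    (f : C -> C) : Prop :=
  [/\ holomorphic_on_H f, transforms N k chi f
    & exists M : nat, bounded_at_infty (fun tau => qpar tau ^+ M * f tau)].

(* f = \sum_n a n q^n on the upper half plane, with finite principal part. *)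
Definition qexpansion (f : C -> C) (a : int -> C) : Prop :=
  exists M : nat,
    (forall n : int, n < - M%:Z -> a n = 0) /\
    (forall tau : C, upper_half tau ->
       (series (fun j : nat => a (j%:Z - M%:Z) * qpar tau ^ (j%:Z - M%:Z))
          : nat -> C^o) @ \oo --> (f tau : C^o)).

(* M_{k'}(Gamma0plus N, chi psi^{k'-k}) is nonzero *)
Definition nonzero_forms (N : nat) (k : int) (chi : 'M[rat]_2 -> C)
    (k' : nat) : Prop :=
  exists (phi : 'M[rat]_2 -> C) (f : C -> C),
    [/\ is_psi_pow N (k'%:Z - k) phi,
        modular_form N k'%:Z (charM chi phi) f
      & exists2 tau : C, upper_half tau & f tau != 0].

Definition is_kprime (N : nat) (chi : 'M[rat]_2 -> C) (k : int)
    (k' : nat) : Prop :=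
  let ok (j : nat) := ((k1 N)%:Z %| j%:Z - k)%Z /\ nonzero_forms N k chi j in
  ok k' /\ forall j : nat, ok j -> (k' <= j)%N.

(* f is the form f_{k,m}^{(chi)} = q^{-m} + O(q^{l+1}), and a n is the
   coefficient of q^n in it: a n = a_k^{(chi)}(m, n) for n >= l + 1. *)
Definition basis_form (N : nat) (k : int) (chi : 'M[rat]_2 -> C) (l m : int)
    (f : C -> C) (a : int -> C) : Prop :=
  [/\ weakly_holomorphic_form N k chi f, qexpansion f a, a (- m) = 1
    & forall n : int, n <= l -> n != - m -> a n = 0].

End Forms.

(* Main.v *)
(* The product F = f g has weight 2 and trivial character, and the coefficient of
   q^0 in F is a n + b m, so that coefficient has to vanish. Integrating the
   q-expansion of F term by term gives G on H with G' = F and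
   G (tau + 1) = G tau + c, where c is the coefficient. By the chain rule
   G o gamma - G is a constant for every gamma in Gamma0plus N, and
   gamma |-> G o gamma - G is a homomorphism from Gamma0plus N to the additive
   group C, hence kills every gamma of finite order modulo scalars. As
   Gamma0plus N \ H has genus 0 and a single cusp, the translation
   tau |-> tau + 1 is a product of such elliptic elements, so c = 0. *)

Require Import Defs.
From HB Require Import structures.
From mathcomp Require Import all_boot all_order all_algebra.
From mathcomp Require Import complex.
From mathcomp Require Import all_classical all_reals all_analysis.
From mathcomp Require Import ring lra zify.

Set Implicit Arguments.
Unset Strict Implicit.
Unset Printing Implicit Defensive.

Import Order.TTheory GRing.Theory Num.Theory.
Import numFieldNormedType.Exports.

Local Open Scope classical_set_scope.
Local Open Scope ring_scope.
Local Open Scope complex_scope.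

(** * Complex modulus and differentiability *)

(** The character of F is chi^2 psi^(-2k), and psi^(-2k) is known only through its values on
    generators; its triviality is therefore checked on exactly the matrices that are used. On Gamma0
    it holds because chi is real and the exponent of psi is even. On the Fricke matrix W_N,
    chi(W_N)^2 = chi(-N) = (-1)^k is cancelled by psi(W_N)^(-2k) = (-1)^k, which explains the twist
    by psi^(-2k). At composite levels one further W_2 or W_3 is needed, and its square must lie in
    the kernel of chi. The genus 0 input takes the form of an explicit factorization at each of the
    nine levels. It holds for an integer multiple of the translation, since Atkin-Lehner matrices
    have determinant m and are not normalized. Periods are handled without path integrals: G is an
    explicit series, and the analysis reduces to the product and chain rules, termwise
    differentiation, and the constancy on H of a function with zero derivative. *)

Section ComplexModulus.
Variable R : realType.
Implicit Types (x y : R) (z w : R[i]).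

(** A modulus with values in R: the norm of [R[i]] takes its values in [R[i]], whose order is only
    partial, while all estimates below are real inequalities. *)
Definition cnorm z : R := Num.sqrt (complex.Re z ^+ 2 + complex.Im z ^+ 2).

Lemma cnormE z : cnorm z = ComplexField.Normc.normc z.
Proof. by case: z. Qed.

Lemma normr_cnorm z : `|z| = (cnorm z)%:C.
Proof. by rewrite normc_def. Qed.

Lemma cnorm_ge0 z : 0 <= cnorm z. Proof. exact: sqrtr_ge0. Qed.

Lemma cnorm0 : cnorm 0 = 0.
Proof. by rewrite cnormE ComplexField.Normc.normc0. Qed.

Lemma cnorm1 : cnorm 1 = 1.
Proof. by rewrite cnormE ComplexField.Normc.normc1. Qed.

Lemma cnormM z w : cnorm (z * w) = cnorm z * cnorm w.
Proof. by rewrite !cnormE ComplexField.Normc.normcM. Qed.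

Lemma cnormV z : cnorm z^-1 = (cnorm z)^-1.
Proof. by rewrite !cnormE ComplexField.Normc.normcV. Qed.

Lemma cnormN z : cnorm (- z) = cnorm z.
Proof. by rewrite !cnormE normcN. Qed.

Lemma cnormD z w : cnorm (z + w) <= cnorm z + cnorm w.
Proof. by rewrite !cnormE le_normcD. Qed.

Lemma cnormB z w : cnorm (z - w) <= cnorm z + cnorm w.
Proof. by rewrite -(cnormN w) cnormD. Qed.

Lemma cnorm_distC z w : cnorm (z - w) = cnorm (w - z).
Proof. by rewrite -cnormN opprB. Qed.

Lemma cnormX z n : cnorm (z ^+ n) = cnorm z ^+ n.
Proof. by elim: n => [|n IH]; rewrite ?expr0 ?cnorm1// !exprS cnormM IH. Qed.

Lemma cnorm_real x : cnorm x%:C = `|x|.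
Proof. by rewrite /cnorm /= expr0n addr0 sqrtr_sqr. Qed.

Lemma cnorm_nat n : cnorm n%:R = n%:R.
Proof.
have -> : (n%:R : R[i]) = (n%:R : R)%:C by rewrite rmorph_nat.
by rewrite cnorm_real ger0_norm.
Qed.

Lemma cnorm_eq0 z : (cnorm z == 0) = (z == 0).
Proof.
apply/eqP/eqP => [|->]; last exact: cnorm0.
by rewrite cnormE => /ComplexField.Normc.eq0_normc.
Qed.

Lemma cnorm_gt0 z : (0 < cnorm z) = (z != 0).
Proof. by rewrite lt_neqAle cnorm_ge0 andbT eq_sym cnorm_eq0. Qed.

Lemma sqr_cnorm z : cnorm z ^+ 2 = complex.Re z ^+ 2 + complex.Im z ^+ 2.
Proof. by rewrite sqr_sqrtr// addr_ge0 ?sqr_ge0. Qed.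

Lemma normRe_le_cnorm z : `|complex.Re z| <= cnorm z.
Proof. by rewrite -sqrtr_sqr ler_wsqrtr// lerDl sqr_ge0. Qed.

Lemma normIm_le_cnorm z : `|complex.Im z| <= cnorm z.
Proof. by rewrite -sqrtr_sqr ler_wsqrtr// lerDr sqr_ge0. Qed.

Lemma cnorm_le_ReIm z : cnorm z <= `|complex.Re z| + `|complex.Im z|.
Proof.
rewrite -(@ler_pXn2r _ 2)// ?nnegrE ?cnorm_ge0 ?addr_ge0//.
rewrite sqr_cnorm sqrrD !real_normK ?num_real//.
by have := mulr_ge0 (normr_ge0 (complex.Re z)) (normr_ge0 (complex.Im z)); lra.
Qed.

Lemma cnorm_sum n (u : nat -> R[i]) :
  cnorm (\sum_(i < n) u i) <= \sum_(i < n) cnorm (u i).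
Proof.
elim: n => [|n IH]; first by rewrite !big_ord0 cnorm0.
by rewrite !big_ord_recr /= (le_trans (cnormD _ _))// lerD2r.
Qed.

Lemma cnorm_lip z w : `|cnorm z - cnorm w| <= cnorm (z - w).
Proof.
have h1 := cnormD (z - w) w; rewrite subrK in h1.
have h2 := cnormD (w - z) z; rewrite subrK cnorm_distC in h2.
by rewrite ler_norml; apply/andP; split; lra.
Qed.

End ComplexModulus.

Section QuadraticDifferentiability.
Variable R : realType.
Local Notation C := R[i].
Implicit Types (f g : C -> C) (z w d e : C).

(* Complex differentiability with a quadratic remainder: every holomorphic
   function satisfies it, and it makes the calculus rules purely algebraic. *)
Definition qdiff f z d := exists K r : R, [/\ 0 <= K, 0 < r &
  forall w, cnorm (w - z) < r ->
    cnorm (f w - f z - d * (w - z)) <= K * cnorm (w - z) ^+ 2].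

Lemma qdiff_ext f g z d (r : R) : 0 < r ->
  (forall w, cnorm (w - z) < r -> f w = g w) -> qdiff f z d -> qdiff g z d.
Proof.
move=> r0 fg [K [s [K0 s0 fK]]]; exists K, (Num.min r s).
split=> // [|w]; first by rewrite lt_min r0.
rewrite lt_min => /andP[wr ws].
by rewrite -!fg// ?subrr ?cnorm0//; exact: fK.
Qed.

Lemma qdiff_cst a z : qdiff (fun=> a) z 0.
Proof.
exists 0, 1; split=> // w _.
by rewrite subrr mul0r subr0 cnorm0 mul0r.
Qed.

Lemma qdiff_id z : qdiff id z 1.
Proof.
exists 0, 1; split=> // w _.
by rewrite mul1r subrr cnorm0 mul0r.
Qed.

Lemma qdiffD f g z d e :
  qdiff f z d -> qdiff g z e -> qdiff (fun w => f w + g w) z (d + e).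
Proof.
move=> [K [r [K0 r0 fK]]] [L [s [L0 s0 gL]]].
exists (K + L), (Num.min r s); split=> [||w]; first exact: addr_ge0.
  by rewrite lt_min r0.
rewrite lt_min => /andP[/fK h1 /gL h2].
have -> : f w + g w - (f z + g z) - (d + e) * (w - z) =
  (f w - f z - d * (w - z)) + (g w - g z - e * (w - z)) by ring.
by rewrite (le_trans (cnormD _ _))// [leRHS]mulrDl lerD.
Qed.

(** Controls the second-order terms that arise in the product rule and in the chain rule. *)
Lemma qdiff_locally_lip f z d : qdiff f z d -> exists L r : R, [/\ 0 <= L, 0 < r &
  forall w, cnorm (w - z) < r -> cnorm (f w - f z) <= L * cnorm (w - z)].
Proof.
move=> [K [r [K0 r0 fK]]]; exists (K * r + cnorm d), r; split=> //.
  by rewrite addr_ge0 ?cnorm_ge0// mulr_ge0// ltW.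
move=> w wr; have -> : f w - f z = (f w - f z - d * (w - z)) + d * (w - z).
  by rewrite subrK.
rewrite (le_trans (cnormD _ _))// cnormM [leRHS]mulrDl lerD//.
apply: (le_trans (fK _ wr)); rewrite -mulrA ler_wpM2l// expr2.
by rewrite ler_wpM2r ?cnorm_ge0// ltW.
Qed.

Lemma qdiffM f g z d e : qdiff f z d -> qdiff g z e ->
  qdiff (fun w => f w * g w) z (d * g z + f z * e).
Proof.
move=> fd ge; have [L [t [L0 t0 fL]]] := qdiff_locally_lip fd.
have [L' [t' [L0' t0' gL]]] := qdiff_locally_lip ge.
move: fd ge => [K [r [K0 r0 fK]]] [M [s [M0 s0 gM]]].
exists (K * cnorm (g z) + cnorm (f z) * M + L * L').
exists (Num.min (Num.min r s) (Num.min t t')).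
split=> [||w]; first by rewrite !addr_ge0 ?mulr_ge0 ?cnorm_ge0.
  by rewrite !lt_min r0 s0 t0.
rewrite !lt_min => /andP[/andP[/fK h1 /gM h2] /andP[/fL h3 /gL h4]].
have -> : f w * g w - f z * g z - (d * g z + f z * e) * (w - z) =
  (f w - f z - d * (w - z)) * g z + f z * (g w - g z - e * (w - z))
  + (f w - f z) * (g w - g z) by ring.
apply: (le_trans (cnormD _ _)); rewrite [leRHS]mulrDl lerD//; last first.
  rewrite cnormM expr2 mulrACA ler_pM ?cnorm_ge0//.
rewrite (le_trans (cnormD _ _))// [leRHS]mulrDl lerD// cnormM.
  by rewrite mulrAC ler_wpM2r ?cnorm_ge0.
by rewrite -mulrA ler_wpM2l ?cnorm_ge0.
Qed.

Lemma qdiffZ a f z d : qdiff f z d -> qdiff (fun w => a * f w) z (a * d).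
Proof.
by move=> fd; have := qdiffM (qdiff_cst a z) fd; rewrite mul0r add0r.
Qed.

Lemma qdiff_comp f g z d e : qdiff g z e -> qdiff f (g z) d ->
  qdiff (fun w => f (g w)) z (d * e).
Proof.
move=> ge fd; have [L [t [L0 t0 gL]]] := qdiff_locally_lip ge.
move: fd ge => [K [r [K0 r0 fK]]] [M [s [M0 s0 gM]]].
exists (K * L ^+ 2 + cnorm d * M).
exists (Num.min (Num.min s t) (r / (L + 1))).
split=> [||w]; first by rewrite addr_ge0 ?mulr_ge0 ?cnorm_ge0 ?exprn_ge0.
  by rewrite !lt_min s0 t0 divr_gt0//; lra.
rewrite !lt_min => /andP[/andP[/gM h2 /gL h3] wr].
have gr : cnorm (g w - g z) < r.
  rewrite (le_lt_trans h3)//; move: wr; rewrite ltr_pdivlMr; last lra.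
  apply: le_lt_trans; rewrite mulrC ler_wpM2l ?cnorm_ge0//; lra.
have -> : f (g w) - f (g z) - d * e * (w - z) =
  (f (g w) - f (g z) - d * (g w - g z)) + d * (g w - g z - e * (w - z)) by ring.
rewrite (le_trans (cnormD _ _))// [leRHS]mulrDl lerD//.
  rewrite (le_trans (fK _ gr))// -mulrA ler_wpM2l// -exprMn.
  by rewrite lerXn2r// ?nnegrE ?mulr_ge0 ?cnorm_ge0.
by rewrite cnormM -mulrA ler_wpM2l ?cnorm_ge0.
Qed.

Lemma qdiffV z : z != 0 -> qdiff (fun w => w^-1) z (- z ^- 2).
Proof.
move=> z0; have z0' : 0 < cnorm z by rewrite cnorm_gt0.
exists (2 / cnorm z ^+ 3), (cnorm z / 2); split.
- by rewrite divr_ge0// exprn_ge0// ltW.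
- by rewrite divr_gt0.
move=> w wz; have hw : cnorm z / 2 < cnorm w.
  have := cnorm_lip w z; rewrite ler_norml => /andP[+ _]; lra.
have w0 : w != 0 by rewrite -cnorm_gt0; lra.
have -> : w^-1 - z^-1 - - z ^- 2 * (w - z) = (w - z) ^+ 2 * (w * z ^+ 2)^-1.
  by field; rewrite z0 w0.
rewrite cnormM cnormX mulrC ler_wpM2r ?exprn_ge0 ?cnorm_ge0// cnormV cnormM cnormX.
have -> : 2 / cnorm z ^+ 3 = (cnorm z / 2 * cnorm z ^+ 2)^-1.
  by field; rewrite gt_eqF.
rewrite lef_pV2 ?posrE ?mulr_gt0 ?exprn_gt0//; last lra.
by rewrite ler_wpM2r ?exprn_ge0 ?cnorm_ge0// ltW.
Qed.

End QuadraticDifferentiability.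

(** * The complex exponential and the parameter q *)

Section ComplexExponential.
Variable R : realType.
Local Notation C := R[i].
Implicit Types (x y : R) (z w : C).

Lemma cexp0 : cexp (0 : C) = 1.
Proof. by rewrite /cexp /= expR0 cos0 sin0 mul1r. Qed.

Lemma cexpD z w : cexp (z + w) = cexp z * cexp w.
Proof.
case: z w => [a b] [c d]; rewrite /cexp /= expRD cosD sinD.
by apply/eqP; rewrite eq_complex /=; apply/andP; split; apply/eqP; ring.
Qed.

Lemma cnorm_cexp z : cnorm (cexp z) = expR (complex.Re z).
Proof.
rewrite /cexp cnormM cnorm_real ger0_norm ?expR_ge0// /cnorm /=.
by rewrite cos2Dsin2 sqrtr1 mulr1.
Qed.

Lemma cexp_neq0 z : cexp z != 0.
Proof. by rewrite -cnorm_gt0 cnorm_cexp expR_gt0. Qed.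

Lemma cexpN z : cexp (- z) = (cexp z)^-1.
Proof.
by apply: (mulIf (cexp_neq0 z)); rewrite mulVf ?cexp_neq0// -cexpD addNr cexp0.
Qed.

Lemma cexpMn z n : cexp (z *+ n) = cexp z ^+ n.
Proof.
elim: n => [|n IH]; first by rewrite mulr0n expr0 cexp0.
by rewrite mulrS cexpD IH exprS.
Qed.

Lemma sin_bound x : `|sin x| <= `|x|.
Proof.
wlog x0 : x / 0 < x => [H|].
  have [x0|x0|->] := ltrgtP x 0; last by rewrite sin0.
    by rewrite -normrN -(normrN x) -sinN; apply: H; rewrite oppr_gt0.
  exact: H.
have [c _] := @MVT_segment R sin cos 0 x (ltW x0) (fun x _ => is_derive_sin x)
  (continuous_subspaceT (@continuous_sin R)).
rewrite sin0 !subr0 => ->; rewrite normrM -[leRHS]mul1r ler_wpM2r//.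
by rewrite ler_norml cos_geN1 cos_le1.
Qed.

Lemma cos_sub1_bound x : `|cos x - 1| <= x ^+ 2.
Proof.
wlog x0 : x / 0 < x => [H|].
  have [x0|x0|->] := ltrgtP x 0; last by rewrite cos0 subrr normr0 sqr_ge0.
    by rewrite -sqrrN -cosN; apply: H; rewrite oppr_gt0.
  exact: H.
have [c] := @MVT_segment R cos (fun x => - sin x) 0 x (ltW x0) (fun x _ => is_derive_cos x)
  (continuous_subspaceT (@continuous_cos R)).
rewrite in_itv /= => /andP[c0 cx].
rewrite cos0 !subr0 => ->; rewrite normrM (gtr0_norm x0) expr2 ler_wpM2r ?(ltW x0)//.
by rewrite normrN (le_trans (sin_bound _))// ger0_norm.
Qed.

Lemma sin_sub_bound x : `|x| <= 1 -> `|sin x - x| <= x ^+ 2.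
Proof.
wlog x0 : x / 0 < x => [H|].
  have [x0|x0|->] := ltrgtP x 0; last by rewrite sin0 subrr normr0 sqr_ge0.
    by rewrite -normrN -sqrrN -(normrN (_ - _)) opprD -sinN; apply: H; rewrite oppr_gt0.
  exact: H.
have df (y : R) : is_derive y 1 (fun y => sin y - y) (cos y - 1).
  by apply: is_deriveB.
have cf : continuous (fun y : R => sin y - y).
  by move=> y; apply: cvgB; [exact: continuous_sin|exact: cvg_id].
rewrite (gtr0_norm x0) => x1.
have [c] := @MVT_segment R _ _ 0 x (ltW x0) (fun x _ => df x)
  (continuous_subspaceT cf).
rewrite in_itv /= => /andP[c0 cx].
rewrite sin0 !subr0 => ->; rewrite normrM (gtr0_norm x0) expr2 ler_wpM2r ?(ltW x0)//.
apply: (le_trans (cos_sub1_bound _)); nra.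
Qed.

(** Both bounds come from exp y >= 1 + y, taken at y = x and at y = -x; the latter gives (1 - x) exp
    x <= 1, and 1 - x >= 1/2. *)
Lemma expR_sub1_bound x : `|x| <= 1 / 2 -> `|expR x - 1 - x| <= 2 * x ^+ 2.
Proof.
rewrite ler_norml => /andP[x1 x2].
have h1 := expR_ge1Dx x; have h2 := expR_ge1Dx (- x).
rewrite expRN in h2; have h3 := expR_gt0 x.
have h4 : (1 - x) * expR x <= 1.
  by rewrite -ler_pdivlMr ?div1r.
rewrite ger0_norm; last lra.
have h5 : 0 <= (expR x - 1 - x) * (1 / 2 - x) by rewrite mulr_ge0//; lra.
lra.
Qed.

(** Real estimates for exp, cos and sin are needed at the origin only; the functional equation
    [cexpD] carries the derivative to every other point. *)
Lemma qdiff_cexp0 : qdiff (@cexp R) 0 1.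
Proof.
(* The constant is generous: the estimates below add up to 4 (x^2 + y^2) + |x| |y|, at most 9/2
   times x^2 + y^2. *)
exists 20, (1 / 2); split=> // -[x y]; rewrite subr0 cexp0 => hn; rewrite mul1r.
have hx : `|x| <= 1 / 2 by apply: ltW; apply: le_lt_trans hn; exact: (normRe_le_cnorm (x +i* y)).
have hy : `|y| <= 1 / 2 by apply: ltW; apply: le_lt_trans hn; exact: (normIm_le_cnorm (x +i* y)).
have hE := expR_sub1_bound hx; have hC := cos_sub1_bound y.
have hS : `|sin y - y| <= y ^+ 2 by apply: sin_sub_bound; lra.
rewrite sqr_cnorm (le_trans (cnorm_le_ReIm _))// /cexp /=.
move: (expR x) (cos y) (sin y) hE hC hS => E c s hE hC hS.
rewrite !(mul0r, mulr0, subr0, addr0).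
have -> : E * c - 1 - x = (E - 1 - x) + E * (c - 1) by ring.
have -> : E * s - y = E * (s - y) + (E - 1 - x) * y + x * y by ring.
have E2 : `|E| <= 2.
  move: hE hx; rewrite !ler_norml => /andP[? ?] /andP[? ?]; apply/andP; split; nra.
have E0 := normr_ge0 E.
have x2 : `|x| ^+ 2 = x ^+ 2 by rewrite real_normK ?num_real.
have y2 : `|y| ^+ 2 = y ^+ 2 by rewrite real_normK ?num_real.
have := ler_normD (E - 1 - x) (E * (c - 1)); rewrite normrM => h1.
have := ler_normD (E * (s - y) + (E - 1 - x) * y) (x * y); rewrite normrM => h2.
have := ler_normD (E * (s - y)) ((E - 1 - x) * y); rewrite !normrM => h3.
have h4 : `|E| * `|c - 1| <= 2 * y ^+ 2 by rewrite ler_pM.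
have h5 : `|E| * `|s - y| <= 2 * y ^+ 2 by rewrite ler_pM.
have h6 : `|E - 1 - x| * `|y| <= 2 * x ^+ 2 * 1 by rewrite ler_pM//; lra.
have h7 : 0 <= (`|x| - `|y|) ^+ 2 by exact: sqr_ge0.
have h8 := sqr_ge0 x; have h9 := sqr_ge0 y.
move: h7; rewrite sqrrB x2 y2; lra.
Qed.

Lemma qdiff_cexp z : qdiff (@cexp R) z (cexp z).
Proof.
have : qdiff (fun w => cexp z * cexp (w - z)) z (cexp z * (1 * (1 + 0))).
  apply: qdiffZ; apply: (@qdiff_comp _ _ (fun w => w - z)).
    by apply: qdiffD; [exact: qdiff_id|exact: qdiff_cst].
  by rewrite subrr; exact: qdiff_cexp0.
rewrite addr0 !mulr1; apply: (@qdiff_ext _ _ _ _ _ 1) => // w _.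
by rewrite -cexpD addrC subrK.
Qed.

Definition twopii : C := (2 * pi)%:C * (0 +i* 1).

Lemma qparE (tau : C) : qpar tau = cexp (twopii * tau). Proof. by []. Qed.

Lemma twopii_neq0 : twopii != 0.
Proof.
rewrite mulf_eq0 negb_or; apply/andP; split.
  by rewrite -cnorm_gt0 cnorm_real normr_gt0 mulf_neq0// gt_eqF// pi_gt0.
by apply/eqP => -[/eqP]; rewrite oner_eq0.
Qed.

Lemma qpar_neq0 (tau : C) : qpar tau != 0.
Proof. exact: cexp_neq0. Qed.

Lemma cnorm_qpar (tau : C) : cnorm (qpar tau) = expR (- (2 * pi * complex.Im tau)).
Proof.
rewrite cnorm_cexp; case: tau => a b /=; congr expR; ring.
Qed.

Lemma cnorm_qpar_lt1 (tau : C) : upper_half tau -> cnorm (qpar tau) < 1.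
Proof.
move=> ht; rewrite cnorm_qpar expR_lt1 oppr_lt0 mulr_gt0// mulr_gt0//.
exact: pi_gt0.
Qed.

Lemma qparD1 (tau : C) : qpar (tau + 1) = qpar tau.
Proof.
rewrite !qparE mulrDr mulr1 cexpD.
suff -> : cexp twopii = 1 by rewrite mulr1.
rewrite /cexp /twopii /= !mul0r !mulr0 !mulr1 subrr addr0 expR0 mul1r.
rewrite mulrC mulr_natr.
have := @cosD2pi R 0; have := @sinD2pi R 0.
by rewrite !add0r cos0 sin0 => -> ->.
Qed.

(** Positive real values of q suffice, because they serve only to bound the coefficients of a
    q-expansion. *)
Lemma qpar_surj (r : R) : 0 < r < 1 ->
  exists2 tau : C, upper_half tau & qpar tau = r%:C.
Proof.
move=> /andP[r0 r1]; exists (0 +i* (- ln r / (2 * pi))).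
  by rewrite /upper_half /= divr_gt0// ?mulr_gt0 ?pi_gt0// oppr_gt0 ln_lt0// r0.
rewrite /qpar /cexp /= !(mul0r, mulr0, mulr1, mul1r, subr0, add0r, addr0, oppr0).
rewrite cos0 sin0 mulrC [_ * (_ / _)]mulrC divfK; last first.
  by rewrite mulf_neq0// gt_eqF// pi_gt0.
by rewrite opprK lnK ?posrE// -[_ +i* 0]/(1 : C) mul1r.
Qed.

End ComplexExponential.

(** * Functions with zero derivative on the upper half plane *)

Section ZeroDerivative.
Variable R : realType.
Local Notation C := R[i].

Lemma quadratic_variation_cst (h : R -> R) :
  (forall x, exists K r : R, [/\ 0 <= K, 0 < r &
     forall y, `|y - x| < r -> `|h y - h x| <= K * `|y - x| ^+ 2]) ->
  forall x y, h x = h y.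
Proof.
move=> hK x y; apply: is_derive_0_is_cst => {y}{}x.
have [K [r [K0 r0 hx]]] := hK x.
apply/is_derive1_caratheodory; exists (fun z => (h z - h x) / (z - x)).
split=> [z||]; last by rewrite subrr mul0r.
  have [->|zx] := eqVneq z x; first by rewrite !subrr mulr0.
  by rewrite divfK// subr_eq0.
apply/cvgrPdist_lt => e e0; rewrite subrr mul0r.
exists (Num.min r (e / (K + 1))) => /=.
  by rewrite lt_min r0 divr_gt0//; lra.
move=> z /=; rewrite distrC lt_min => /andP[zr ze].
rewrite sub0r normrN normrM normfV.
have [->|zx] := eqVneq z x; first by rewrite !subrr normr0 mul0r.
have zx0 : 0 < `|z - x| by rewrite normr_gt0 subr_eq0.
rewrite ltr_pdivrMr// (le_lt_trans (hx z zr))// expr2 mulrA ltr_pM2r//.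
rewrite ltr_pdivlMr in ze; last lra.
apply: le_lt_trans ze; rewrite mulrC ler_wpM2l//; lra.
Qed.

(** Along a locally Lipschitz path the increments of L are of second order in the parameter, so the
    real and imaginary parts of L o p have zero derivative. This reduces constancy to functions of
    one real variable. *)
Lemma qdiff0_path (L : C -> C) (p : R -> C) :
  (forall tau, upper_half tau -> qdiff L tau 0) ->
  (forall t, upper_half (p t)) ->
  (forall t, exists M r : R, [/\ 0 < M, 0 < r &
     forall s, `|s - t| < r -> cnorm (p s - p t) <= M * `|s - t|]) ->
  forall s t, L (p s) = L (p t).
Proof.
move=> dL pH pM s t.
have main x : exists K r : R, [/\ 0 <= K, 0 < r & forall y, `|y - x| < r ->
    cnorm (L (p y) - L (p x)) <= K * `|y - x| ^+ 2].
  have [K [r [K0 r0 LK]]] := dL _ (pH x); have [M [d [M0 d0 pMx]]] := pM x.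
  exists (K * M ^+ 2), (Num.min d (r / M)); split.
  - by rewrite mulr_ge0// exprn_ge0// ltW.
  - by rewrite lt_min d0 divr_gt0.
  move=> y; rewrite lt_min ltr_pdivlMr// => /andP[/pMx h1 yr].
  have := LK (p y); rewrite mul0r subr0 => H; apply: le_trans (H _) _.
    by rewrite (le_lt_trans h1)// mulrC.
  by rewrite -mulrA ler_wpM2l// -exprMn lerXn2r ?nnegrE ?cnorm_ge0// mulr_ge0// ltW.
apply/eqP; rewrite eq_complex; apply/andP; split; apply/eqP.
- apply: (@quadratic_variation_cst (fun t => complex.Re (L (p t)))) => x.
  have [K [r [K0 r0 hK]]] := main x; exists K, r; split=> // y /hK.
  by apply: le_trans; rewrite -raddfB normRe_le_cnorm.
- apply: (@quadratic_variation_cst (fun t => complex.Im (L (p t)))) => x.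
  have [K [r [K0 r0 hK]]] := main x; exists K, r; split=> // y /hK.
  by apply: le_trans; rewrite -raddfB normIm_le_cnorm.
Qed.

Lemma qdiff0_cst (L : C -> C) :
  (forall tau, upper_half tau -> qdiff L tau 0) ->
  forall tau tau', upper_half tau -> upper_half tau' -> L tau = L tau'.
Proof.
move=> dL [a b] [c d]; rewrite /upper_half /= => b0 d0.
have -> : L (a +i* b) = L (c +i* b).
  apply: (@qdiff0_path L (fun t => t +i* b)) => // t.
  exists 1, 1; split=> // s _.
  rewrite mul1r (le_trans (cnorm_le_ReIm _))//=.
  by rewrite subrr normr0 addr0.
(* After the horizontal line comes the vertical one; the exponential parametrization keeps a path
   defined on all of R inside H. *)
rewrite -(lnK b0) -(lnK d0).
apply: (@qdiff0_path L (fun t => c +i* expR t)) => // t.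
  exact: expR_gt0.
exists (2 * expR t), (1 / 2); split=> [||s st]; rewrite ?mulr_gt0 ?expR_gt0//.
rewrite (le_trans (cnorm_le_ReIm _))//= subrr normr0 add0r.
have -> : expR s - expR t = expR t * (expR (s - t) - 1).
  by rewrite mulrBr mulr1 -expRD [t + _]addrC subrK.
rewrite normrM ger0_norm ?expR_ge0// [2 * _]mulrC -mulrA ler_wpM2l ?expR_ge0//.
have := expR_sub1_bound (ltW st).
have := ler_normD (expR (s - t) - 1 - (s - t)) (s - t); rewrite subrK.
have x2 : `|s - t| ^+ 2 = (s - t) ^+ 2 by rewrite real_normK ?num_real.
rewrite -x2; have := normr_ge0 (s - t) => h0 h1 h2.
nra.
Qed.

End ZeroDerivative.

(** * Power series *)

Section ComplexSeries.
Variable R : realType.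
Local Notation C := R[i].
Implicit Types (u v x y : nat -> C) (s t : C).

Definition ccvg u s := forall e : R, 0 < e ->
  exists n0, forall n, (n0 <= n)%N -> cnorm (u n - s) < e.

Definition psum u n := \sum_(i < n) u i.

Lemma ccvgP u s : ((u : nat -> C^o) @ \oo --> (s : C^o)) <-> ccvg u s.
Proof.
split=> [/cvgrPdist_lt us e e0|us].
  have /us : 0 < e%:C by rewrite ltcR.
  case=> n0 _ h; exists n0 => n /h /=.
  by rewrite normr_cnorm ltcR cnorm_distC.
apply/cvgrPdist_lt => e; rewrite ltcE /= => /andP[/eqP e1 e0].
have [n0 h] := us _ e0; exists n0 => // n /h /=.
by rewrite normr_cnorm cnorm_distC ltcE /= e1 eqxx.
Qed.

Lemma ccvg_ext u v s : u =1 v -> ccvg u s -> ccvg v s.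
Proof. by move=> uv us e /us[n0 h]; exists n0 => n /h; rewrite uv. Qed.

Lemma ccvgD u v s t : ccvg u s -> ccvg v t -> ccvg (fun n => u n + v n) (s + t).
Proof.
move=> us vt e e0; have e2 : 0 < e / 2 by lra.
have [n0 h] := us _ e2; have [n1 k] := vt _ e2.
exists (maxn n0 n1) => n; rewrite geq_max => /andP[/h {}h /k {}k].
rewrite opprD addrACA (le_lt_trans (cnormD _ _))//; lra.
Qed.

Lemma ccvgZ (a : C) u s : ccvg u s -> ccvg (fun n => a * u n) (a * s).
Proof.
move=> us e e0; have a0 := cnorm_ge0 a.
have [|n0 h] := us (e / (cnorm a + 1)); first by rewrite divr_gt0//; lra.
exists n0 => n /h; rewrite ltr_pdivlMr; last lra.
rewrite -mulrBr cnormM; apply: le_lt_trans; rewrite mulrC ler_wpM2l ?cnorm_ge0//.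
lra.
Qed.

Lemma ccvg_le u s (B : R) : ccvg u s -> (forall n, cnorm (u n) <= B) -> cnorm s <= B.
Proof.
move=> us uB; apply/ler_addgt0Pr => e /us[n0 /(_ _ (leqnn _)) h].
have := cnormB (u n0) (u n0 - s); rewrite subKr => k.
by have := uB n0; lra.
Qed.

Lemma ccvg_bounded u s : ccvg u s -> exists B : R, forall n, cnorm (u n) <= B.
Proof.
move=> /(_ 1 ltr01)[n0 h]; exists (\sum_(i < n0) cnorm (u i) + (1 + cnorm s)) => n.
have [nn0|nn0] := leqP n0 n.
  have := cnormD (u n - s) s; rewrite subrK => k.
  have := h _ nn0; have : 0 <= \sum_(i < n0) cnorm (u i).
    by rewrite sumr_ge0// => i _; exact: cnorm_ge0.
  lra.
rewrite (bigD1 (Ordinal nn0))//= -addrA lerDl !addr_ge0 ?cnorm_ge0//.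
by rewrite sumr_ge0// => i _; exact: cnorm_ge0.
Qed.

Lemma ccvgM u v s t : ccvg u s -> ccvg v t -> ccvg (fun n => u n * v n) (s * t).
Proof.
move=> us vt; have [B vB] := ccvg_bounded vt.
have B0 : 0 <= B by rewrite (le_trans _ (vB 0%N)) ?cnorm_ge0.
move=> e e0; have s0 := cnorm_ge0 s.
have [|n0 h] := us (e / (2 * (B + 1))); first by rewrite divr_gt0//; lra.
have [|n1 k] := vt (e / (2 * (cnorm s + 1))); first by rewrite divr_gt0//; lra.
exists (maxn n0 n1) => n; rewrite geq_max => /andP[/h {}h /k {}k].
rewrite ltr_pdivlMr in h; last lra.
rewrite ltr_pdivlMr in k; last lra.
have -> : u n * v n - s * t = (u n - s) * v n + s * (v n - t) by ring.
rewrite (le_lt_trans (cnormD _ _))// !cnormM.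
have h1 : cnorm (u n - s) * cnorm (v n) <= cnorm (u n - s) * B.
  by rewrite ler_wpM2l ?cnorm_ge0.
have h2 := cnorm_ge0 (u n - s); have h3 := cnorm_ge0 (v n - t).
lra.
Qed.

Lemma ccvg_psum_bounded u s :
  ccvg (psum u) s -> exists B : R, forall n, cnorm (u n) <= B.
Proof.
move=> /ccvg_bounded[B h]; exists (B + B) => n.
have -> : u n = psum u n.+1 - psum u n by rewrite [psum _ _.+1]big_ord_recr /= addrAC subrr add0r.
by rewrite (le_trans (cnormB _ _))// lerD.
Qed.

Lemma psumD u v n : psum (fun i => u i + v i) n = psum u n + psum v n.
Proof. exact: big_split. Qed.

Lemma psumZ (a : C) u n : psum (fun i => a * u i) n = a * psum u n.
Proof. by rewrite /psum mulr_sumr. Qed.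

Lemma geometric_psum_le (r : R) n : 0 <= r < 1 ->
  \sum_(i < n) r ^+ i <= (1 - r)^-1.
Proof.
move=> /andP[r0 r1]; rewrite -[leRHS]mul1r ler_pdivlMr; last lra.
have -> : (\sum_(i < n) r ^+ i) * (1 - r) = 1 - r ^+ n.
  by rewrite -[RHS]opprB subrX1 -mulNr opprB mulrC.
by rewrite lerBlDr lerDl exprn_ge0.
Qed.

(** The left-hand side is a sum of n copies of r^n, each at most r^i for i < n, hence at most a
    geometric sum. *)
Lemma natr_expr_le (r : R) n : 0 <= r < 1 -> n%:R * r ^+ n <= (1 - r)^-1.
Proof.
move=> /andP[r0 r1]; apply: le_trans (geometric_psum_le n _); last by rewrite r0.
have -> : n%:R * r ^+ n = \sum_(i < n) r ^+ n.
  by rewrite sumr_const card_ord mulr_natl.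
by apply: ler_sum => i _; rewrite ler_wiXn2l// ?(ltW r1)// ltnW.
Qed.

(* n^2 t^n is dominated by a convergent geometric sequence: take
   r = (2 + t) / 3, so that t <= r^3. *)
Lemma sqr_expr_le (t : R) : 0 <= t < 1 ->
  exists B r : R, [/\ 0 <= B, 0 <= r < 1 &
    forall n, n%:R ^+ 2 * t ^+ n <= B * r ^+ n].
Proof.
move=> /andP[t0 t1]; pose r : R := (2 + t) / 3.
have r01 : 0 <= r < 1 by rewrite /r; lra.
exists ((1 - r) ^- 2), r; split=> // [|n].
  by rewrite invr_ge0 exprn_ge0//; lra.
have /andP[r0 r1] := r01.
(* With t = 3 r - 2 the difference r^3 - t factors as (r - 1)^2 (r + 2). *)
have tr : t <= r ^+ 3.
  have -> : t = 3 * r - 2 by rewrite /r; field.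
  have : 0 <= (r - 1) ^+ 2 * (r + 2) by rewrite mulr_ge0 ?sqr_ge0//; lra.
  lra.
apply: (@le_trans _ _ ((n%:R * r ^+ n) ^+ 2 * r ^+ n)).
  rewrite exprMn -[leRHS]mulrA ler_wpM2l ?exprn_ge0// -exprM -exprD.
  have -> : (n * 2 + n = 3 * n)%N by lia.
  by rewrite exprM lerXn2r// ?nnegrE ?exprn_ge0.
rewrite ler_wpM2r ?exprn_ge0// -exprVn lerXn2r// ?nnegrE.
- by rewrite mulr_ge0 ?exprn_ge0.
- by rewrite invr_ge0; lra.
- exact: natr_expr_le.
Qed.

Lemma geometric_small (t B e : R) : 0 <= t < 1 -> 0 <= B -> 0 < e ->
  exists n0, forall n, (n0 <= n)%N -> B * t ^+ n < e.
Proof.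
move=> /andP[t0 t1] B0 e0.
have : (B *: (fun n => t ^+ n : R)) @ \oo --> B *: (0 : R).
  by apply: cvgZr; apply: cvg_expr; rewrite ger0_norm.
rewrite scaler0 => /cvgrPdist_lt /(_ _ e0)[n0 _ h]; exists n0 => n /h /=.
by rewrite sub0r normrN ger0_norm// mulr_ge0 ?exprn_ge0.
Qed.

Lemma real_series_cvg (h : nat -> R) (B t : R) : 0 <= t < 1 ->
  (forall n, `|h n| <= B * t ^+ n) -> exists l : R, series h @ \oo --> l.
Proof.
move=> /andP[t0 t1] hB; exists (limn (series h)).
apply: (@normed_cvg R R^o h).
apply: (@series_le_cvg _ _ (geometric B t)) => [n|n|n|].
- exact: normr_ge0.
- exact: le_trans (hB n).
- exact: hB.
by apply: is_cvg_geometric_series; rewrite ger0_norm.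
Qed.

Lemma psum_cvg u (B t : R) : 0 <= t < 1 ->
  (forall n, cnorm (u n) <= B * t ^+ n) -> exists s, ccvg (psum u) s.
Proof.
move=> t01 uB.
have [|a ha] := @real_series_cvg (fun n => complex.Re (u n)) B t t01.
  by move=> n; exact: le_trans (normRe_le_cnorm _) (uB n).
have [|b hb] := @real_series_cvg (fun n => complex.Im (u n)) B t t01.
  by move=> n; exact: le_trans (normIm_le_cnorm _) (uB n).
exists (a +i* b) => e e0; have e2 : 0 < e / 2 by lra.
move/cvgrPdist_lt : ha => /(_ _ e2)[n0 _ ha].
move/cvgrPdist_lt : hb => /(_ _ e2)[n1 _ hb].
exists (maxn n0 n1) => n; rewrite geq_max => /andP[/ha {}ha /hb {}hb].
rewrite (le_lt_trans (cnorm_le_ReIm _))// !raddfB /= /psum !raddf_sum /=.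
move: ha hb; rewrite /series /= !big_mkord !(distrC _ (\sum_(_ < _) _)).
lra.
Qed.

Definition cauchy_prod x y n := \sum_(i < n.+1) x i * y (n - i)%N.

Lemma psum_cauchy_prod x y n :
  psum (cauchy_prod x y) n = \sum_(i < n) x i * psum y (n - i).
Proof.
elim: n => [|n IH]; first by rewrite /psum !big_ord0.
rewrite {1}/psum big_ord_recr /= -/(psum _ n) IH /cauchy_prod.
rewrite (big_ord_recr n) /= addrA -big_split /=.
rewrite [RHS]big_ord_recr /=; congr (_ + _).
  apply: eq_bigr => i _; rewrite subSn ?(ltnW (ltn_ord i))// -mulrDr.
  by rewrite /psum big_ord_recr.
by rewrite subnn subSnn /psum big_ord1.
Qed.

Lemma psum_tail_le y (B t : R) n i : 0 <= t <= 1 -> 0 <= B -> (i <= n)%N ->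
  (forall j, cnorm (y j) <= B * t ^+ j) ->
  cnorm (psum y n - psum y (n - i)) <= i%:R * (B * t ^+ (n - i)).
Proof.
move=> /andP[t0 t1] B0 + yB; elim: i => [_|i IH lt_in].
  by rewrite subn0 subrr cnorm0 mul0r.
have eqn : (n - i = (n - i.+1).+1)%N by lia.
have {}IH := IH (ltnW lt_in).
have -> : psum y n - psum y (n - i.+1) =
   (psum y n - psum y (n - i)) + y (n - i.+1)%N.
  by rewrite eqn [psum y _.+1]big_ord_recr /= -/(psum _ _); ring.
rewrite (le_trans (cnormD _ _))// -natr1 [leRHS]mulrDl mul1r lerD//.
rewrite (le_trans IH)// ler_wpM2l// ler_wpM2l// eqn exprS.
by rewrite ler_piMl// exprn_ge0.
Qed.

(** The n-th partial sum of the Cauchy product differs from the product of the n-th partial sums X_n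
    Y_n by the sum over i < n of x_i (Y_(n-i) - Y_n). Each term is at most B^2 n t^n, so the error
    is at most B^2 n^2 t^n and tends to 0. *)
Lemma cauchy_prod_cvg x y s s' (B t : R) : 0 <= t < 1 ->
  (forall n, cnorm (x n) <= B * t ^+ n) -> (forall n, cnorm (y n) <= B * t ^+ n) ->
  ccvg (psum x) s -> ccvg (psum y) s' -> ccvg (psum (cauchy_prod x y)) (s * s').
Proof.
move=> t01 xB yB xs ys; have /andP[t0 t1] := t01.
have B0 : 0 <= B.
  by have := xB 0%N; rewrite expr0 mulr1; apply: le_trans; exact: cnorm_ge0.
have [D [r [D0 r01 hD]]] := sqr_expr_le t01.
have err n : cnorm (psum (cauchy_prod x y) n - psum x n * psum y n) <=
    B ^+ 2 * D * r ^+ n.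
  rewrite -mulrA; apply: le_trans (ler_wpM2l (sqr_ge0 B) (hD n)).
  rewrite psum_cauchy_prod mulr_suml -sumrB -cnormN -sumrN.
  apply: (le_trans (cnorm_sum _ (fun i => - (x i * psum y (n - i) - x i * psum y n)))).
  have -> : B ^+ 2 * (n%:R ^+ 2 * t ^+ n) = \sum_(i < n) B ^+ 2 * (n%:R * t ^+ n).
    by rewrite sumr_const card_ord -mulr_natl; ring.
  apply: ler_sum => i _.
  rewrite -mulrBr -mulrN opprB cnormM.
  apply: (@le_trans _ _ (B * t ^+ i * (i%:R * (B * t ^+ (n - i))))).
    rewrite ler_pM ?cnorm_ge0//; apply: psum_tail_le => //; last exact: ltnW.
    by rewrite t0 ltW.
  have -> : B * t ^+ i * (i%:R * (B * t ^+ (n - i))) =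
      i%:R * (B ^+ 2 * (t ^+ i * t ^+ (n - i))) by ring.
  rewrite -exprD subnKC ?(ltnW (ltn_ord i))// mulrCA ler_wpM2l ?sqr_ge0//.
  by rewrite ler_wpM2r ?exprn_ge0// ler_nat ltnW.
have e0 : ccvg (fun n => psum (cauchy_prod x y) n - psum x n * psum y n) 0.
  move=> e e0; have [|n0 h] := @geometric_small r (B ^+ 2 * D) e r01 _ e0.
    by rewrite mulr_ge0// sqr_ge0.
  by exists n0 => n /h; rewrite subr0; apply: le_lt_trans.
have := ccvgD e0 (ccvgM xs ys); rewrite add0r; apply: ccvg_ext => n.
by rewrite subrK.
Qed.

End ComplexSeries.

Section PowerSeries.
Variable R : realType.
Local Notation C := R[i].
Implicit Types (A d : nat -> C) (z w : C).

(* The coefficients of a power series of radius of convergence at least 1. *)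
Definition disc_coef A :=
  forall r : R, 0 < r < 1 -> exists B : R, forall j, cnorm (A j) * r ^+ j <= B.

(** Boundedness at an intermediate radius s with r < s < 1 yields geometric decay at r, with ratio r
    / s. *)
Lemma disc_coef_geometric A (r : R) : disc_coef A -> 0 <= r < 1 ->
  exists B t : R, [/\ 0 <= B, 0 <= t < 1 &
    forall j, cnorm (A j) * r ^+ j <= B * t ^+ j].
Proof.
move=> dA /andP[r0 r1]; pose s : R := (1 + r) / 2.
have s0 : 0 < s by rewrite /s; lra.
have s1 : s < 1 by rewrite /s; lra.
have rs : r < s by rewrite /s; lra.
have [|B hB] := dA s; first by rewrite s0.
exists B, (r / s); split=> [||j].
- by have := hB 0%N; rewrite mulr1; apply: le_trans; exact: cnorm_ge0.
- by rewrite divr_ge0 ?(ltW s0)// ltr_pdivrMr// mul1r.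
rewrite expr_div_n mulrA ler_pdivlMr ?exprn_gt0//.
by rewrite mulrAC ler_wpM2r// exprn_ge0.
Qed.

Lemma disc_coef_sqr_geometric A (r : R) : disc_coef A -> 0 <= r < 1 ->
  exists B t : R, [/\ 0 <= B, 0 <= t < 1 &
    forall j, cnorm (A j) * (j%:R ^+ 2 * r ^+ j) <= B * t ^+ j].
Proof.
move=> dA r01; have [B [t [B0 t01 hB]]] := disc_coef_geometric dA r01.
have [D [s [D0 s01 hD]]] := sqr_expr_le t01.
exists (B * D), s; split=> [||j]; rewrite ?mulr_ge0//.
rewrite mulrCA (le_trans (ler_wpM2l (sqr_ge0 _) (hB j)))//.
by rewrite mulrCA -[leRHS]mulrA ler_wpM2l.
Qed.

Lemma disc_coef_cvg A z : disc_coef A -> cnorm z < 1 ->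
  exists s, ccvg (psum (fun j => A j * z ^+ j)) s.
Proof.
move=> dA z1; have [|B [t [_ t01 hB]]] := @disc_coef_geometric A (cnorm z) dA.
  by rewrite cnorm_ge0.
by apply: (psum_cvg t01 (B := B)) => n; rewrite cnormM cnormX.
Qed.

(** The remainders satisfy E_(n+1) = w E_n + n z^(n-1) (w - z)^2, and n^2 + n <= (n+1)^2 closes the
    induction. Writing z^n / z for z^(n-1) and multiplying by r^2 avoids negative exponents for n =
    0 and n = 1. *)
Lemma exprn_taylor_bound z w (r : R) n : z != 0 -> cnorm z <= r -> cnorm w <= r ->
  cnorm (w ^+ n - z ^+ n - n%:R * (z ^+ n / z) * (w - z)) * r ^+ 2 <=
  n%:R ^+ 2 * r ^+ n * cnorm (w - z) ^+ 2.
Proof.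
move=> z0 zr wr; have r0 : 0 <= r by rewrite (le_trans (cnorm_ge0 z)).
elim: n => [|n IH].
  by rewrite !expr0 mul0r subrr mul0r subr0 cnorm0 mul0r !mulr_ge0 ?exprn_ge0 ?cnorm_ge0.
have -> : w ^+ n.+1 - z ^+ n.+1 - n.+1%:R * (z ^+ n.+1 / z) * (w - z) =
    w * (w ^+ n - z ^+ n - n%:R * (z ^+ n / z) * (w - z))
    + n%:R * (z ^+ n / z) * (w - z) ^+ 2.
  by rewrite -natr1 !exprS; field.
have h2 : n%:R * cnorm (z ^+ n / z) * r ^+ 2 <= n%:R * r ^+ n.+1.
  case: n {IH} => [|n]; first by rewrite !mul0r.
  rewrite -mulrA ler_wpM2l// exprSr mulfK// cnormX.
  have -> : r ^+ n.+2 = r ^+ n * r ^+ 2 by rewrite -exprD addn2.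
  apply: ler_wpM2r; first exact: exprn_ge0.
  by apply: lerXn2r; rewrite ?nnegrE ?cnorm_ge0.
have h1 : cnorm w * (cnorm (w ^+ n - z ^+ n - n%:R * (z ^+ n / z) * (w - z)) * r ^+ 2)
    <= r * (n%:R ^+ 2 * r ^+ n * cnorm (w - z) ^+ 2).
  by rewrite ler_pM ?cnorm_ge0 ?mulr_ge0 ?cnorm_ge0 ?exprn_ge0.
have x0 : 0 <= cnorm (w - z) ^+ 2 by rewrite exprn_ge0 ?cnorm_ge0.
have h3 := ler_wpM2r x0 h2.
apply: (@le_trans _ _ ((n%:R ^+ 2 + n%:R) * r ^+ n.+1 * cnorm (w - z) ^+ 2)).
  apply: le_trans (ler_wpM2r (exprn_ge0 2 r0) (cnormD _ _)) _.
  move: h1 h3; rewrite [cnorm (w * _)]cnormM [cnorm (_ * _ ^+ 2)]cnormM cnormX.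
  rewrite [cnorm (n%:R * _)]cnormM cnorm_nat (exprS r n); lra.
rewrite ler_wpM2r// ler_wpM2r ?exprn_ge0// -natr1.
by have : 0 <= n%:R :> R := ler0n _ _; nra.
Qed.

(** Termwise Taylor remainders are dominated by j^2 |d_j| r^j, which is summable for |z| < r < 1.
    The derivative is given as s / z with s the sum of j d_j z^j, so that the series keeps its
    indexing; z is a value of q in the application, hence nonzero. *)
Lemma qdiff_power_series d (P : C -> C) z s : disc_coef d ->
  (forall w, cnorm w < 1 -> ccvg (psum (fun j => d j * w ^+ j)) (P w)) ->
  z != 0 -> cnorm z < 1 ->
  ccvg (psum (fun j => j%:R * d j * z ^+ j)) s -> qdiff P z (s / z).
Proof.
move=> dd hP z0 z1 hs; pose r : R := (1 + cnorm z) / 2.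
have zg0 : 0 < cnorm z by rewrite cnorm_gt0.
have r0 : 0 < r by rewrite /r; lra.
have r1 : r < 1 by rewrite /r; lra.
have zr : cnorm z < r by rewrite /r; lra.
have [|B [t [B0 t01 hB]]] := @disc_coef_sqr_geometric d r dd; first by rewrite ltW.
have /andP[t0 t1] := t01.
exists (B * (1 - t)^-1 / r ^+ 2), (r - cnorm z); split.
- by rewrite divr_ge0 ?exprn_ge0 ?(ltW r0)// mulr_ge0// invr_ge0; lra.
- lra.
move=> w wz; have wr : cnorm w <= r.
  by have := cnormD (w - z) z; rewrite subrK; lra.
have w1 : cnorm w < 1 by lra.
have lim : ccvg (psum (fun j => d j * (w ^+ j - z ^+ j - j%:R * (z ^+ j / z) * (w - z))))
    (P w - P z - s / z * (w - z)).
  have -> : P w - P z - s / z * (w - z) =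
    (P w + (-1) * P z) + (- (w - z) / z) * s by field.
  have h := ccvgD (ccvgD (hP _ w1) (ccvgZ (-1) (hP _ z1))) (ccvgZ (- (w - z) / z) hs).
  apply: ccvg_ext h => n.
  rewrite -!psumZ -!psumD /psum; apply: eq_bigr => j _; field; exact: z0.
apply: (ccvg_le lim) => n.
apply: (le_trans (cnorm_sum _ _)).
apply: (@le_trans _ _ (\sum_(i < n) (B * t ^+ i * cnorm (w - z) ^+ 2 / r ^+ 2))).
  apply: ler_sum => i _; rewrite ler_pdivlMr ?exprn_gt0// cnormM -[leLHS]mulrA.
  have h1 := exprn_taylor_bound i z0 (ltW zr) wr.
  apply: (le_trans (ler_wpM2l (cnorm_ge0 _) h1)); rewrite mulrA.
  by rewrite ler_wpM2r ?exprn_ge0 ?cnorm_ge0.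
rewrite -mulr_suml -mulr_suml -mulr_sumr [leRHS]mulrAC ler_wpM2r//.
  by rewrite invr_ge0 exprn_ge0// ltW.
rewrite ler_wpM2r ?exprn_ge0 ?cnorm_ge0// ler_wpM2l//.
exact: geometric_psum_le.
Qed.

End PowerSeries.

(** * Products and primitives of q-expansions *)

Section QExpansions.
Variable R : realType.
Local Notation C := R[i].
Implicit Types (f g F : C -> C) (a b c : int -> C) (tau : C).

Lemma expz_sub (z : C) (j M : nat) : z != 0 ->
  z ^ (j%:Z - M%:Z) = z ^+ j / z ^+ M.
Proof. by move=> z0; rewrite expfzDr// -invr_expz. Qed.

(** Integer powers of q become quotients q^j / q^M of natural powers, which turns a q-expansion into
    a power series divided by q^M. *)
Lemma qexpansionP f a : qexpansion f a <-> exists M : nat,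
  (forall n : int, n < - M%:Z -> a n = 0) /\
  forall tau, upper_half tau ->
    ccvg (psum (fun j : nat => a (j%:Z - M%:Z) * (qpar tau ^+ j / qpar tau ^+ M))) (f tau).
Proof.
have E (M : nat) tau : series (fun j : nat => a (j%:Z - M%:Z) * qpar tau ^ (j%:Z - M%:Z))
    =1 psum (fun j : nat => a (j%:Z - M%:Z) * (qpar tau ^+ j / qpar tau ^+ M)).
  move=> n; rewrite /series /psum /= big_mkord; apply: eq_bigr => j _.
  by rewrite expz_sub// qpar_neq0.
split=> -[M [aM h]]; exists M; split=> // tau /h.
  by move/ccvgP => H; exact: ccvg_ext (E M tau) H.
by move=> H; apply/ccvgP; exact: ccvg_ext (fsym (E M tau)) H.
Qed.

Lemma qexpansion_disc_coef f a (M : nat) :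
  (forall tau, upper_half tau ->
    ccvg (psum (fun j : nat => a (j%:Z - M%:Z) * (qpar tau ^+ j / qpar tau ^+ M))) (f tau)) ->
  disc_coef (fun j : nat => a (j%:Z - M%:Z)).
Proof.
move=> h r r01; have [tau tauH qr] := qpar_surj r01.
have /andP[r0 r1] := r01.
have [B hB] := ccvg_psum_bounded (h _ tauH); exists (B * r ^+ M) => j.
have := hB j; rewrite qr !cnormM cnormV !cnormX cnorm_real ger0_norm ?(ltW r0)//.
by rewrite mulrA ler_pdivrMr ?exprn_gt0.
Qed.

Lemma ccvg_psum_pick (x : C) (M : nat) :
  ccvg (psum (fun j => if j == M then x else 0)) x.
Proof.
move=> e e0; exists M.+1 => n Mn.
rewrite /psum -big_mkcond /= (big_pred1 (Ordinal Mn)) ?subrr ?cnorm0//.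
Qed.

(** Dividing coefficients by their exponents does not enlarge them; n = 0 is covered by the
    convention that the inverse of 0 is 0. *)
Lemma cnorm_intV_le1 (n : int) : cnorm (n%:~R : C)^-1 <= 1.
Proof.
have [->|n0] := eqVneq n 0; first by rewrite invr0 cnorm0.
have -> : (n%:~R : C) = (n%:~R : R)%:C by rewrite rmorph_int.
rewrite cnormV cnorm_real invf_le1 ?normr_gt0 ?intr_eq0//.
by rewrite -intr_norm ler1z -gtz0_ge1 normr_gt0.
Qed.

Lemma qexpansion_primitive F c : qexpansion F c -> exists G : C -> C,
  (forall tau, upper_half tau -> qdiff G tau (F tau)) /\
  forall tau, G (tau + 1) = G tau + c 0.
Proof.
move=> /qexpansionP[M [_ h]]; have dA := qexpansion_disc_coef h.
(* At j = M the denominator is 0 and [d] takes the value 0: the constant term of F drops out of the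
   series and is integrated separately to c 0 * tau. *)
pose A j := c (j%:Z - M%:Z); pose d (j : nat) : C := A j / (j%:Z - M%:Z)%:~R.
have dd : disc_coef d.
  move=> r r01; have [B hB] := dA r r01; exists B => j.
  have /andP[r0 _] := r01; apply: le_trans (hB j).
  rewrite ler_wpM2r ?exprn_ge0 ?(ltW r0)// cnormM -[leRHS]mulr1.
  by rewrite ler_wpM2l ?cnorm_ge0// cnorm_intV_le1.
have [P hP] : {P : C -> C & forall w, cnorm w < 1 ->
    ccvg (psum (fun j => d j * w ^+ j)) (P w)}.
  apply: (@choice _ _ (fun w s => cnorm w < 1 -> ccvg (psum (fun j => d j * w ^+ j)) s)).
  move=> w; have [w1|w1] := ltP (cnorm w) 1; last by exists 0.
  by have [s hs] := disc_coef_cvg dd w1; exists s.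
have EM tau : cexp (- (M%:R * twopii R) * tau) = (qpar tau ^+ M)^-1.
  by rewrite qparE -cexpMn -cexpN; congr cexp; rewrite -[in RHS]mulr_natl; ring.
exists (fun tau => c 0 * tau +
  (twopii R)^-1 * (cexp (- (M%:R * twopii R) * tau) * P (qpar tau))).
split=> [tau tauH|tau]; last by rewrite !EM qparD1 mulrDr mulr1 addrAC.
have t0 := twopii_neq0 R; have q0 := qpar_neq0 tau.
have q1 := cnorm_qpar_lt1 tauH; have qM0 : qpar tau ^+ M != 0 by rewrite expf_neq0.
(* For j distinct from M, j d_j = A_j + M d_j; summing and removing the term A_M = c 0 gives the
   value of the series of j d_j q^j. *)
pose s := qpar tau ^+ M * F tau - qpar tau ^+ M * c 0 + M%:R * P (qpar tau).
have hs : ccvg (psum (fun j => j%:R * d j * qpar tau ^+ j)) s.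
  have := ccvgD (ccvgD (ccvgZ (qpar tau ^+ M) (h _ tauH))
    (ccvg_psum_pick (- (qpar tau ^+ M * c 0)) M)) (ccvgZ M%:R (hP _ q1)).
  apply: ccvg_ext => n; rewrite -!psumZ -!psumD; apply: eq_bigr => j _.
  rewrite /d /A; case: eqP => [->|/eqP jM].
    by rewrite subrr invr0 !mulr0 !mul0r !mulr0 mulrCA mulfV// mulr1 addr0 mulrC subrr.
  have jM0 : (j%:Z - M%:Z)%:~R != 0 :> C by rewrite intr_eq0 subr_eq0 eqz_nat.
  move: jM0; rewrite intrB -!pmulrn => jM0; field.
  by rewrite jM0 qM0.
have dP := qdiff_power_series dd hP q0 q1 hs.
have dlin (x : C) : qdiff (fun w => x * w) tau (x * 1) by apply/qdiffZ/qdiff_id.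
have dq : qdiff (@qpar R) tau (qpar tau * (twopii R * 1)).
  by apply: (qdiff_comp (dlin _)); exact: qdiff_cexp.
have dE := qdiff_comp (dlin (- (M%:R * twopii R))) (@qdiff_cexp R _).
have := qdiffD (dlin (c 0)) (qdiffZ (twopii R)^-1 (qdiffM dE (qdiff_comp dq dP))).
congr qdiff; rewrite EM /s; field.
by rewrite t0 q0 qM0.
Qed.

(** The orders M and M' are returned together with the product, since they delimit the finite sum
    that gives the constant coefficient: the exponents of f run from -M to M'. *)
Lemma qexpansionM f g a b : qexpansion f a -> qexpansion g b ->
  exists (c : int -> C) (M M' : nat),
  [/\ qexpansion (fun tau => f tau * g tau) c,
      forall n : int, n < - M%:Z -> a n = 0,
      forall n : int, n < - M'%:Z -> b n = 0
    & c 0 = \sum_(i < (M + M').+1) a (i%:Z - M%:Z) * b (M%:Z - i%:Z)].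
Proof.
move=> /qexpansionP[M [aM ha]] /qexpansionP[M' [bM hb]].
pose A (j : nat) := a (j%:Z - M%:Z); pose B (j : nat) := b (j%:Z - M'%:Z).
(* Exponent n sits at index n + M + M' of the Cauchy product; exponent 0 thus has M + M' + 1
   summands. *)
pose c (n : int) := if n < - (M + M')%N%:Z then 0
  else cauchy_prod A B (absz (n + (M + M')%N%:Z)).
exists c, M, M'; split=> //; last first.
  rewrite /c ltNge oppr_le0 /= add0n.
  apply: eq_bigr => i _; rewrite /A /B; congr (a _ * b _).
  have := ltn_ord i; lia.
apply/qexpansionP; exists (M + M')%N; split=> [n|tau tauH]; first by rewrite /c => ->.
have q0 := qpar_neq0 tau; have q1 := cnorm_qpar_lt1 tauH.
have q01 : 0 <= cnorm (qpar tau) < 1 by rewrite cnorm_ge0.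
have [B1 [t1 [B10 t101 h1]]] := disc_coef_geometric (qexpansion_disc_coef ha) q01.
have [B2 [t2 [B20 t201 h2]]] := disc_coef_geometric (qexpansion_disc_coef hb) q01.
pose x j := A j * qpar tau ^+ j; pose y j := B j * qpar tau ^+ j.
have hx : ccvg (psum x) (qpar tau ^+ M * f tau).
  apply: ccvg_ext (ccvgZ (qpar tau ^+ M) (ha _ tauH)) => n.
  rewrite -psumZ; apply: eq_bigr => j _; rewrite /x /A; field.
  by rewrite expf_neq0.
have hy : ccvg (psum y) (qpar tau ^+ M' * g tau).
  apply: ccvg_ext (ccvgZ (qpar tau ^+ M') (hb _ tauH)) => n.
  rewrite -psumZ; apply: eq_bigr => j _; rewrite /y /B; field.
  by rewrite expf_neq0.
have /andP[t10 t11] := t101; have /andP[t20 t21] := t201.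
have xyP (B3 t3 : R) (u : nat -> C) : 0 <= B3 -> 0 <= t3 ->
    B3 <= Num.max B1 B2 -> t3 <= Num.max t1 t2 ->
    (forall j, cnorm (u j) * cnorm (qpar tau) ^+ j <= B3 * t3 ^+ j) ->
  forall j, cnorm (u j * qpar tau ^+ j) <= Num.max B1 B2 * (Num.max t1 t2) ^+ j.
  move=> B30 t30 B3B t3t h j; rewrite cnormM cnormX (le_trans (h j))//.
  rewrite ler_pM ?exprn_ge0// lerXn2r// ?nnegrE//.
  exact: le_trans t3t.
have Bt0 : 0 <= Num.max t1 t2 < 1 by rewrite le_max t10 gt_max t11 t21.
have maxl (u v : R) : u <= Num.max u v by rewrite le_max lexx.
have maxr (u v : R) : v <= Num.max u v by rewrite le_max lexx orbT.
have hxy := cauchy_prod_cvg Bt0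
  (xyP _ _ _ B10 t10 (maxl _ _) (maxl _ _) h1)
  (xyP _ _ _ B20 t20 (maxr _ _) (maxr _ _) h2) hx hy.
have -> : f tau * g tau = (qpar tau ^+ (M + M'))^-1 *
    (qpar tau ^+ M * f tau * (qpar tau ^+ M' * g tau)).
  by rewrite exprD; field; rewrite !expf_neq0.
apply: ccvg_ext (ccvgZ _ hxy) => n; rewrite -psumZ; apply: eq_bigr => j _.
have -> : cauchy_prod x y j = cauchy_prod A B j * qpar tau ^+ j.
  rewrite /cauchy_prod mulr_suml; apply: eq_bigr => i _.
  rewrite /x /y mulrACA; congr (_ * _); rewrite -exprD subnKC//.
  by have := ltn_ord i; rewrite ltnS.
by rewrite /c ltNge lerDr /= subrK absz_nat mulrCA [_^-1 * _]mulrC.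
Qed.

End QExpansions.

(** * Moebius transformations *)

Section Moebius.
Variable R : realType.
Local Notation C := R[i].
Implicit Types (g h : 'M[rat]_2) (tau : C).

Lemma det_mx22 (K : comPzRingType) (g : 'M[K]_2) : \det g = g 0 0 * g 1 1 - g 0 1 * g 1 0.
Proof.
rewrite (expand_det_row _ 0) !big_ord_recl big_ord0 addr0 /cofactor !det_mx11 !mxE /=.
rewrite addn0 expr0 mul1r expr1 mulN1r mulrN.
by congr (g _ _ * g _ _ - g _ _ * g _ _); apply/val_inj.
Qed.

Lemma ratr_complex (r : rat) : (ratr r : C) = (ratr r : R)%:C.
Proof. by rewrite fmorph_rat. Qed.

Lemma moebius_denom_neq0 g tau : 0 < \det g -> upper_half tau ->
  ratr (g 1 0) * tau + ratr (g 1 1) != 0 :> C.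
Proof.
case: tau => x y; rewrite /upper_half /= det_mx22 => det0 y0.
rewrite !ratr_complex eq_complex /= negb_and.
have [c0|c0] := eqVneq (g 1 0) 0; last first.
  by apply/orP; right; rewrite mul0r !addr0 mulf_neq0 ?fmorph_eq0// gt_eqF.
rewrite c0 rmorph0 !mul0r subrr add0r fmorph_eq0; apply/orP; left.
by apply: contraTneq det0 => ->; rewrite c0 !mulr0 subrr ltxx.
Qed.

Lemma moebius_upper_half g tau : 0 < \det g -> upper_half tau ->
  upper_half (moebius g tau).
Proof.
move=> det0 tauH; have := moebius_denom_neq0 det0 tauH.
rewrite -cnorm_gt0 => /(exprn_gt0 2); rewrite sqr_cnorm.
move: det0 tauH; rewrite det_mx22 /moebius /upper_half.
case: tau => x y; rewrite !ratr_complex /=.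
rewrite -(ltr0q R) rmorphB !rmorphM /=.
move: (ratr (g 0 0)) (ratr (g 0 1)) (ratr (g 1 0)) (ratr (g 1 1)) => a b c d.
rewrite !mul0r !subr0 !addr0 => det0 y0 N0.
set n := (_ + _) in N0 *.
have -> : (a * x + b) * - ((c * y) / n) + (a * y) * ((c * x + d) / n) =
  (a * d - b * c) * y / n by field; rewrite gt_eqF.
by rewrite divr_gt0// mulr_gt0.
Qed.

Lemma moebiusM g h tau : 0 < \det g -> 0 < \det h -> upper_half tau ->
  moebius (g *m h) tau = moebius g (moebius h tau).
Proof.
move=> dg dh tauH; have hH := moebius_upper_half dh tauH.
have d1 := moebius_denom_neq0 dh tauH; have d2 := moebius_denom_neq0 dg hH.
have d3 : 0 < \det (g *m h) by rewrite det_mulmx mulr_gt0.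
have {d3} := moebius_denom_neq0 d3 tauH.
move: d1 d2; rewrite /moebius !mxE !big_ord_recl !big_ord0 !addr0 /=.
have -> : lift ord0 ord0 = 1 :> 'I_2 by apply/val_inj.
have -> : ord0 = 0 :> 'I_2 by [].
rewrite !rmorphD !rmorphM /=.
move: (ratr (g 0 0)) (ratr (g 0 1)) (ratr (g 1 0)) (ratr (g 1 1)).
move: (ratr (h 0 0)) (ratr (h 0 1)) (ratr (h 1 0)) (ratr (h 1 1)).
move=> a' b' c' d' a b c d d1 d2 d3.
field; rewrite d1 /=.
have -> : c * (a' * tau + b') + d * (c' * tau + d') =
  (c * a' + d * c') * tau + (c * b' + d * d') by ring.
by rewrite d3.
Qed.

Lemma moebius_scalar (s : rat) tau : s != 0 -> moebius s%:M tau = tau.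
Proof.
move=> s0; rewrite /moebius !mxE /= rmorph0 addr0 mul0r add0r mulrAC mulfV ?mul1r//.
by rewrite fmorph_eq0.
Qed.

Lemma qdiff_moebius g tau : 0 < \det g -> upper_half tau ->
  qdiff (moebius g) tau
    (ratr (\det g) * (ratr (g 1 0) * tau + ratr (g 1 1)) ^ (- 2%:Z)).
Proof.
move=> dg tauH; have d0 := moebius_denom_neq0 dg tauH.
have dlin (x y : C) : qdiff (fun w => x * w + y) tau (x * 1 + 0).
  by apply: qdiffD; [apply/qdiffZ/qdiff_id|exact: qdiff_cst].
have := qdiffM (dlin (ratr (g 0 0)) (ratr (g 0 1)))
  (qdiff_comp (dlin (ratr (g 1 0)) (ratr (g 1 1))) (qdiffV d0)).
rewrite -exprnN -/(moebius g); congr qdiff.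
rewrite det_mx22 rmorphB !rmorphM /=; move: d0.
move: (ratr (g 0 0)) (ratr (g 0 1)) (ratr (g 1 0)) (ratr (g 1 1)) => a b c d d0.
by field.
Qed.

Definition invariant2 (F : C -> C) g :=
  forall tau, upper_half tau -> slash 2 F g tau = F tau.

(** In weight 2 the automorphy factor is exactly the derivative of the Moebius map found in
    [qdiff_moebius]. *)
Lemma slash2E (F : C -> C) g tau : 0 < \det g ->
  slash 2 F g tau = ratr (\det g) *
    (ratr (g 1 0) * tau + ratr (g 1 1)) ^ (- 2%:Z) * F (moebius g tau).
Proof.
move=> dg; rewrite /slash divff ?powRr1 ?ler0q ?(ltW dg)// -?ratr_complex//.
Qed.

Lemma slashM (k k' : int) (f f' : C -> C) g tau : 0 < \det g -> upper_half tau ->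
  slash k f g tau * slash k' f' g tau = slash (k + k') (fun w => f w * f' w) g tau.
Proof.
move=> dg tauH; have d0 := moebius_denom_neq0 dg tauH.
rewrite /slash opprD expfzDr// intrD mulrDl powRD; last first.
  by apply/implyP => _; rewrite gt_eqF// ltr0q.
rewrite rmorphM /=; ring.
Qed.

(* The chain rule turns weight 2 invariance of F into d/dtau (G o g - G) = 0. *)
Lemma primitive_period (F G : C -> C) g :
  (forall tau, upper_half tau -> qdiff G tau (F tau)) ->
  0 < \det g -> invariant2 F g ->
  exists x, forall tau, upper_half tau -> G (moebius g tau) = G tau + x.
Proof.
move=> dG dg Fg; pose i : C := 0 +i* 1.
have iH : upper_half i by rewrite /upper_half /= ltr01.
exists (G (moebius g i) + -1 * G i) => tau tauH.
have dL t : upper_half t -> qdiff (fun w => G (moebius g w) + -1 * G w) t 0.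
  move=> tH; have gtH := moebius_upper_half dg tH.
  have := qdiffD (qdiff_comp (qdiff_moebius dg tH) (dG _ gtH)) (qdiffZ (-1) (dG _ tH)).
  by congr qdiff; rewrite mulrC -slash2E// Fg// mulN1r subrr.
rewrite (qdiff0_cst dL iH tauH); ring.
Qed.

End Moebius.

(** * The character chi^2 psi^(-2k) *)

Section IntegerMatrices.
Implicit Types (a b c d s : int).

Lemma mx2M a b c d a' b' c' d' :
  mx2 a b c d *m mx2 a' b' c' d' =
  mx2 (a * a' + b * c') (a * b' + b * d') (c * a' + d * c') (c * b' + d * d').
Proof.
by apply/matrixP => i j; rewrite !mxE !big_ord_recl big_ord0 !mxE /= addr0
  -!intrM -intrD; case: (i == 0); case: (j == 0).
Qed.

Lemma mx2_scalar s : mx2 s 0 0 s = (s%:~R)%:M.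
Proof.
apply/matrixP => i j; rewrite !mxE.
by case: i j => [[|[|]]//= ?] [[|[|]]//= ?].
Qed.

Lemma det_mx2 a b c d : \det (mx2 a b c d) = (a * d - b * c)%:~R.
Proof. by rewrite det_mx22 !mxE /= -!intrM -intrB. Qed.

Lemma Gamma0_mx2 N a b c d : a * d - b * c = 1 -> (N%:Z %| c)%Z ->
  Gamma0 N (mx2 a b c d).
Proof. by move=> h1 h2; exists a, b, c, d. Qed.

Lemma det_Gamma0plus N g : (0 < N)%N -> Gamma0plus N g -> 0 < \det g.
Proof.
move=> N0; elim=> {g} [g|g m|g h _ dg _ dh|g _ dg].
- by move=> [a [b [c [d [-> e _]]]]]; rewrite det_mx2 e.
- move=> mN [x [y [z [w [-> e]]]]]; rewrite det_mx2 e ltr0n.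
  by rewrite (dvdn_gt0 N0).
- by rewrite det_mulmx mulr_gt0.
- by rewrite det_inv invr_gt0.
Qed.

End IntegerMatrices.

Section Kronecker.
Local Open Scope int_scope.

Lemma sqr_legendre (a : int) (p : nat) : ~~ (p%:Z %| a)%Z -> legendre a p ^+ 2 = 1.
Proof. by rewrite /legendre => /negPf ->; case: ifP. Qed.

Lemma sqr_kronecker_prime (D : int) (p : nat) :
  ~~ (p%:Z %| D)%Z -> kronecker_prime D p ^+ 2 = 1.
Proof.
rewrite /kronecker_prime; have [->|_] := eqVneq p 2%N; last exact: sqr_legendre.
by move=> /negPf ->; case: ifP.
Qed.

(** No prime factor of n divides D, so every factor of the symbol is a sign. This makes even powers
    of psi trivial on Gamma0. *)
Lemma sqr_kronecker (D n : int) : n != 0 -> coprimez D n -> kronecker D n ^+ 2 = 1.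
Proof.
move=> n0 cop; rewrite /kronecker (negPf n0) exprMn.
rewrite (_ : (if _ then _ else _) ^+ 2 = 1); last by case: ifP.
rewrite mul1r -prodrXl big_seq big1// => p.
rewrite mem_primes => /and3P[pp _ pn]; rewrite -exprM mulnC exprM.
rewrite sqr_kronecker_prime ?expr1n//; apply/negP => pD.
move: cop; rewrite /coprimez /gcdz => /eqP[] g1.
have : (p %| gcdn `|D| `|n|)%N by rewrite dvdn_gcd pn andbT.
by rewrite g1 dvdn1 => /eqP p1; rewrite p1 in pp.
Qed.

Lemma kronecker_posE (D : int) (n : nat) : (0 < n)%N -> kronecker D n%:Z =
  \prod_(p <- primes n) kronecker_prime D p ^+ logn p n.
Proof. by case: n => // n _; rewrite /kronecker /= mul1r. Qed.

End Kronecker.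

Section Characters.
Variable R : realType.
Local Notation C := R[i].

Lemma real_dirichlet_periodic N (e : int -> int) (a t : int) :
  real_dirichlet N e -> e (a + N%:Z * t) = e a.
Proof.
move=> [_ _ eN _]; case: t => n.
  elim: n => [|n IH]; first by rewrite mulr0 addr0.
  by rewrite -[in RHS]IH -[RHS]eN; congr e; rewrite -addn1 PoszD; ring.
rewrite NegzE; elim: n => [|n IH].
  by rewrite -[LHS]eN; congr e; ring.
by rewrite -[in RHS]IH -[LHS]eN; congr e; rewrite -[n.+2]addn1 PoszD; ring.
Qed.

(** Since a d is 1 modulo N, e a and e d are integers with product 1. *)
Lemma real_dirichlet_sqr N (e : int -> int) (a b c d : int) :
  real_dirichlet N e -> a * d - b * c = 1 -> (N%:Z %| c)%Z -> e d ^+ 2 = 1.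
Proof.
move=> he det1 /dvdzP[t ct]; have [e1 eM _ _] := he.
have : e a * e d = 1.
  rewrite -eM -e1 -(real_dirichlet_periodic 1 (b * t) he); congr e.
  by rewrite -[in RHS]det1 ct; ring.
move=> /(congr1 absz)/eqP; rewrite abszM muln_eq1 => /andP[_ /eqP ed1].
by have [->|->] : e d = 1 \/ e d = -1 by lia.
Qed.

End Characters.

Section PairCharacter.
Variables (R : realType) (N : nat) (k : int) (chi psi : 'M[rat]_2 -> R[i]).
Implicit Types g h : 'M[rat]_2.

(* The products f g transform under such g as forms of weight 2 with trivial
   character. *)
Definition unramified g := Gamma0plus N g /\ chi g * charM chi psi g = 1.

Hypothesis N_gt0 : (0 < N)%N.
Hypothesis chi_adm : admissible N k chi.
Hypothesis psi_pow : is_psi_pow N (- (2 * k)) psi.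

Let chiM g h : Gamma0plus N g -> Gamma0plus N h -> chi (g *m h) = chi g * chi h.
Proof. by move=> hg hh; have [[_ ->]] := chi_adm. Qed.

Let psiM g h : Gamma0plus N g -> Gamma0plus N h -> psi (g *m h) = psi g * psi h.
Proof. by move=> hg hh; have [[_ ->]] := psi_pow. Qed.

Let chi2psiM g h : Gamma0plus N g -> Gamma0plus N h ->
  chi (g *m h) * charM chi psi (g *m h) =
  (chi g * charM chi psi g) * (chi h * charM chi psi h).
Proof. by move=> hg hh; rewrite /charM chiM// psiM//; ring. Qed.

Lemma unramifiedM g h : unramified g -> unramified h -> unramified (g *m h).
Proof.
move=> [hg g1] [hh h1]; split; first exact: Gamma0plus_mul.
by rewrite chi2psiM// g1 h1 mulr1.
Qed.

(** Reaches the Atkin-Lehner matrices on which psi is not prescribed: W_3 at level 6, W_7 at level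
    14 and W_5 at level 15 become of type W_N after multiplication by W_2, W_2 and W_3
    respectively. *)
Lemma unramified_cancelr g h :
  Gamma0plus N g -> unramified h -> unramified (g *m h) -> unramified g.
Proof. by move=> hg [hh h1] [_]; rewrite chi2psiM// h1 mulr1. Qed.

Lemma unramified_Gamma0 g : Gamma0 N g -> unramified g.
Proof.
move=> hg; split; first exact: Gamma0plus_Gamma0.
case: hg => a [b [c [d [-> det1 Nc]]]].
have [_ _ _ [e he chie] _] := chi_adm; have [_ psiE _ _ _] := psi_pow.
rewrite /charM mulrA -expr2 chie// -rmorphXn /= (real_dirichlet_sqr he det1 Nc) mul1r.
rewrite psiE// -mulrN.
have exp1 (x : R[i]) : x ^+ 2 = 1 -> x ^ (2 * - k) = 1.
  by move=> x2; rewrite -exprz_exp -exprnP x2 exp1rz.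
apply: exp1; case: ifP => [/andP[Np _]|_]; last by rewrite expr1n.
have cop : coprimez (- N%:Z) a.
  rewrite coprimezE abszN absz_nat prime_coprime//; apply/negP => Na.
  have /dvdzP[s sE] : (N%:Z %| a)%Z by [].
  case/dvdzP: Nc => t tE; have : (N%:Z %| a * d - b * c)%Z.
    by rewrite sE tE; apply/dvdzP; exists (s * d - b * t); ring.
  by rewrite det1 dvdzE /= dvdn1 => /eqP N1; rewrite N1 in Np.
rewrite -rmorphXn /= sqr_kronecker//.
apply: contraTneq cop => ->; rewrite coprimezE abszN absz_nat /coprime gcdn0.
by apply: contraTneq Np => ->.
Qed.

Let Gamma0plusN1 : Gamma0plus N (- 1%:M).
Proof.
have -> : - 1%:M = mx2 (- 1) 0 0 (- 1) by rewrite mx2_scalar mulrNz mulr1z -[RHS]scalemx1 scaleN1r.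
by apply: Gamma0plus_Gamma0; apply: Gamma0_mx2 => //; rewrite dvdz0.
Qed.

Lemma Gamma0plus_Fricke : Gamma0plus N (Fricke N).
Proof.
apply: (Gamma0plus_AL (dvdnn N)); exists 0, (-1), 1, 0; split.
  by rewrite /Fricke !mulr0 mulr1.
by rewrite !mulr0 mulr1; ring.
Qed.

Lemma unramified_Fricke : unramified (Fricke N).
Proof.
have hF := Gamma0plus_Fricke; split=> //.
have FF : Fricke N *m Fricke N = - 1%:M *m (N%:R)%:M.
  rewrite mulNmx mul1mx -[N%:R%:M]scalemx1 -scaleNr scalemx1 pmulrn -rmorphN -mx2_scalar.
  by rewrite /Fricke mx2M; congr mx2; ring.
(* The triviality of chi on positive scalars applies only inside the group, so the scalar N has to
   be exhibited as -W_N^2. *)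
have hN : Gamma0plus N (N%:R)%:M.
  have -> : (N%:R)%:M = - 1%:M *m (Fricke N *m Fricke N).
    by rewrite FF !mulNmx !mul1mx opprK.
  by do 2!apply: Gamma0plus_mul => //.
have [_ chiS chiN1 _ _] := chi_adm; have [_ _ psiF _ _] := psi_pow.
have : chi (Fricke N) * chi (Fricke N) = (-1) ^ k.
  by rewrite -chiM// FF chiM// chiN1 chiS ?mulr1// ltr0n.
rewrite /charM mulrA => ->; rewrite psiF.
have i2 : ((0 +i* 1)^-1 : R[i]) ^+ 2 = -1.
  by rewrite exprVn sqr_i invrN1.
by rewrite -mulrN -exprz_exp -exprnP i2 -expfzDr ?subrr// oppr_eq0 oner_eq0.
Qed.

(** Every Atkin-Lehner matrix of determinant N is an element of Gamma0 times the Fricke matrix. *)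
Lemma unramified_type_N (a b c d : int) : N%:Z * (a * d) - b * c = 1 ->
  unramified (mx2 (N%:Z * a) b (N%:Z * c) (N%:Z * d)).
Proof.
move=> det1.
have -> : mx2 (N%:Z * a) b (N%:Z * c) (N%:Z * d) =
    mx2 (- b) a (- (N%:Z * d)) c *m Fricke N.
  by rewrite /Fricke mx2M; congr mx2; ring.
apply: unramifiedM unramified_Fricke; apply: unramified_Gamma0; apply: Gamma0_mx2.
  by rewrite -det1; ring.
by rewrite -mulrN; apply: dvdz_mulr.
Qed.

(** Here psi is prescribed on g, and chi g need only be known up to sign: chi(g)^2 = chi(s) chi(h) =
    1. *)
Lemma unramified_sqr g h (s : int) : Gamma0plus N g -> Gamma0 N h -> 0 < s ->
  g *m g = mx2 s 0 0 s *m h -> chi h = 1 -> psi g = 1 -> unramified g.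
Proof.
rewrite mx2_scalar => hg hh s0 gg chih psig; split=> //.
have {}hh := Gamma0plus_Gamma0 hh.
have hs : Gamma0plus N (s%:~R)%:M.
  have hu : h \in unitmx by rewrite unitmxE unitfE gt_eqF// (det_Gamma0plus N_gt0).
  by rewrite -(mulmxK hu (s%:~R)%:M) -gg; apply: Gamma0plus_mul; [exact: Gamma0plus_mul|exact: Gamma0plus_inv].
have [_ chiS _ _ _] := chi_adm.
by rewrite /charM psig mulr1 -chiM// gg chiM// chih chiS ?ltr0z// mulr1.
Qed.

End PairCharacter.

(** * Translations as products of elliptic elements *)

Section EllipticGenerators.
Variables (R : realType) (N : nat) (k : int) (chi psi : 'M[rat]_2 -> R[i]).
Hypothesis N_gt0 : (0 < N)%N.
Hypothesis chi_adm : admissible N k chi.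
Hypothesis psi_pow : is_psi_pow N (- (2 * k)) psi.

(** Finite order is meant modulo scalars, so a power of g is required to be a nonzero, possibly
    negative, integer scalar. *)
Inductive elliptic_product : 'M[rat]_2 -> Prop :=
| Elliptic g (r : nat) (s : int) : unramified N chi psi g -> (0 < r)%N -> s != 0 ->
    g ^+ r = (s%:~R)%:M -> elliptic_product g
| EllipticM g h : elliptic_product g -> elliptic_product h ->
    elliptic_product (g *m h).

Lemma elliptic_eq g h : elliptic_product g -> g = h -> elliptic_product h.
Proof. by move=> + <-. Qed.

(** A matrix of trace 0 squares to minus its determinant. *)
Lemma elliptic_involution (a b c : int) : a * a + b * c != 0 ->
  unramified N chi psi (mx2 a b c (- a)) -> elliptic_product (mx2 a b c (- a)).
Proof.
move=> det0 hg; apply: (Elliptic hg (r := 2) _ det0) => //.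
by rewrite expr2 -mulmxE mx2M -mx2_scalar; congr mx2; ring.
Qed.

Lemma elliptic_Fricke_type (a b c : int) : - (N%:Z * (a * a)) - b * c = 1 ->
  elliptic_product (mx2 (N%:Z * a) b (N%:Z * c) (- (N%:Z * a))).
Proof.
move=> det1; apply: elliptic_involution.
  have -> : N%:Z * a * (N%:Z * a) + b * (N%:Z * c) =
    - N%:Z * (- (N%:Z * (a * a)) - b * c) by ring.
  by rewrite det1 mulr1 oppr_eq0 eqz_nat -lt0n.
rewrite -mulrN; apply: (unramified_type_N N_gt0 chi_adm psi_pow).
by rewrite -det1; ring.
Qed.

End EllipticGenerators.

Section Levels.
Variables (R : realType) (k : int) (chi psi : 'M[rat]_2 -> R[i]).

(* The factorizations below are read off the side pairings of the Ford
   fundamental domain of Gamma0plus N. *)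
Definition translation_elliptic N := admissible N k chi ->
  is_psi_pow N (- (2 * k)) psi ->
  exists2 s : int, s != 0 & elliptic_product N chi psi (mx2 s s 0 s).

Lemma translation_elliptic2 : translation_elliptic 2.
Proof.
(* At every level s^2 is the product of the determinants of the factors, here 2 and 2. *)
move=> hchi hpsi; exists 2 => //.
have e1 := @elliptic_Fricke_type R 2 k chi psi isT hchi hpsi 0 (-1) 1 erefl.
have u2 := @unramified_type_N R 2 k chi psi isT hchi hpsi 0 1 (-1) (-1) erefl.
(* The eigenvalues are -1 + i and -1 - i, with fourth power -4; the fixed point (-1 + i)/2 is a
   corner of the fundamental domain. *)
have e2 : elliptic_product 2 chi psi (mx2 0 1 (-2) (-2)).
  apply: (@Elliptic _ _ _ _ _ 4 (-4) u2) => //.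
  by rewrite !exprS expr0 mulr1 -!mulmxE !mx2M -mx2_scalar.
by apply: elliptic_eq (EllipticM e1 e2) _; rewrite !mx2M; congr mx2; ring.
Qed.

Lemma translation_elliptic3 : translation_elliptic 3.
Proof.
move=> hchi hpsi; exists 3 => //.
have e1 := @elliptic_Fricke_type R 3 k chi psi isT hchi hpsi 0 (-1) 1 erefl.
have u2 := @unramified_type_N R 3 k chi psi isT hchi hpsi 0 1 (-1) (-1) erefl.
have e2 : elliptic_product 3 chi psi (mx2 0 1 (-3) (-3)).
  apply: (@Elliptic _ _ _ _ _ 6 (-27) u2) => //.
  by rewrite !exprS expr0 mulr1 -!mulmxE !mx2M -mx2_scalar.
by apply: elliptic_eq (EllipticM e1 e2) _; rewrite !mx2M; congr mx2; ring.
Qed.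

Lemma translation_elliptic5 : translation_elliptic 5.
Proof.
move=> hchi hpsi; exists 5 => //.
have e1 := @elliptic_Fricke_type R 5 k chi psi isT hchi hpsi 1 (-3) 2 erefl.
have e2 := @elliptic_Fricke_type R 5 k chi psi isT hchi hpsi 0 (-1) 1 erefl.
(* An elliptic element of Gamma0(5) itself, fixing (-2 + i)/5. *)
have u3 : unramified 5 chi psi (mx2 (-2) (-1) 5 (- (-2))).
  by apply: (unramified_Gamma0 hchi hpsi); exact: Gamma0_mx2.
have e3 := @elliptic_involution R 5 chi psi (-2) (-1) 5 isT u3.
by apply: elliptic_eq (EllipticM (EllipticM e1 e2) e3) _; rewrite !mx2M; congr mx2; ring.
Qed.

Lemma translation_elliptic7 : translation_elliptic 7.
Proof.
move=> hchi hpsi; exists 7 => //.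
have e1 := @elliptic_Fricke_type R 7 k chi psi isT hchi hpsi 1 (-4) 2 erefl.
have e2 := @elliptic_Fricke_type R 7 k chi psi isT hchi hpsi 0 (-1) 1 erefl.
have u3 : unramified 7 chi psi (mx2 (-2) (-1) 7 3).
  by apply: (unramified_Gamma0 hchi hpsi); exact: Gamma0_mx2.
(* Trace and determinant are 1, so g^2 - g + 1 = 0 and g^3 = -1. *)
have e3 : elliptic_product 7 chi psi (mx2 (-2) (-1) 7 3).
  apply: (@Elliptic _ _ _ _ _ 3 (-1) u3) => //.
  by rewrite !exprS expr0 mulr1 -!mulmxE !mx2M -mx2_scalar.
by apply: elliptic_eq (EllipticM (EllipticM e1 e2) e3) _; rewrite !mx2M; congr mx2; ring.
Qed.

Lemma translation_elliptic11 : translation_elliptic 11.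
Proof.
move=> hchi hpsi; exists (- 11 ^+ 2); first by rewrite oppr_eq0 expf_neq0.
(* The isometric circle of a Fricke-type involution with parameters a, b, c is centred at a/c; the
   centres are 1/2, 1/3, 0 and -1/3. *)
have e1 := @elliptic_Fricke_type R 11 k chi psi isT hchi hpsi 1 (-6) 2 erefl.
have e2 := @elliptic_Fricke_type R 11 k chi psi isT hchi hpsi 1 (-4) 3 erefl.
have e3 := @elliptic_Fricke_type R 11 k chi psi isT hchi hpsi 0 (-1) 1 erefl.
have e4 := @elliptic_Fricke_type R 11 k chi psi isT hchi hpsi (-1) (-4) 3 erefl.
by apply: elliptic_eq (EllipticM (EllipticM e1 e2) (EllipticM e3 e4)) _; rewrite !mx2M; congr mx2; ring.
Qed.

Lemma translation_elliptic23 : translation_elliptic 23.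
Proof.
move=> hchi hpsi; exists (- 23 ^+ 3); first by rewrite oppr_eq0 expf_neq0.
(* The centres are 1/2, 1/3, 1/4, 0, -1/4 and -1/3. *)
have e1 := @elliptic_Fricke_type R 23 k chi psi isT hchi hpsi 1 (-12) 2 erefl.
have e2 := @elliptic_Fricke_type R 23 k chi psi isT hchi hpsi 1 (-8) 3 erefl.
have e3 := @elliptic_Fricke_type R 23 k chi psi isT hchi hpsi 1 (-6) 4 erefl.
have e4 := @elliptic_Fricke_type R 23 k chi psi isT hchi hpsi 0 (-1) 1 erefl.
have e5 := @elliptic_Fricke_type R 23 k chi psi isT hchi hpsi (-1) (-6) 4 erefl.
have e6 := @elliptic_Fricke_type R 23 k chi psi isT hchi hpsi (-1) (-8) 3 erefl.
apply: elliptic_eq (EllipticM (EllipticM e1 (EllipticM e2 e3))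
  (EllipticM e4 (EllipticM e5 e6))) _.
by rewrite !mx2M; congr mx2; ring.
Qed.

End Levels.

(** * Levels with two prime factors *)

Section CompositeLevels.
Variables (R : realType) (k : int) (chi psi : 'M[rat]_2 -> R[i]).

Lemma Gamma0plus_type_m N m (x y z w : int) : (m %| N)%N ->
  m%:Z * x * (m%:Z * w) - y * (N%:Z * z) = m%:Z ->
  Gamma0plus N (mx2 (m%:Z * x) y (N%:Z * z) (m%:Z * w)).
Proof. by move=> mN det; apply: (Gamma0plus_AL mN); exists x, y, z, w. Qed.

Lemma translation_elliptic6 : translation_elliptic k chi psi 6.
Proof.
move=> hchi hpsi; exists 6 => //.
have [_ _ _ _ /(_ isT) chi1] := hchi; have [_ _ _ psi2 _] := hpsi.
have {}chi1 : on_Gamma0 6 chi (fun=> 1) by case: chi1 => [//|[]//|[]//].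
have w2 : AtkinLehner 6 2 (mx2 (-2) (-1) 6 (- (-2))) by exists (-1), (-1), 1, 1.
have u2 : unramified 6 chi psi (mx2 (-2) (-1) 6 (- (-2))).
  apply: (@unramified_sqr R 6 k chi psi isT hchi _ (mx2 (-1) 0 0 (-1)) 2) => //.
  - exact: (Gamma0plus_AL (m := 2)).
  - exact: Gamma0_mx2.
  - by rewrite !mx2M.
  - by rewrite chi1.
  - by apply: psi2 w2; left.
have e2 := elliptic_involution (isT : (-2) * (-2) + (-1) * 6 != 0 :> int) u2.
have e1 := @elliptic_Fricke_type R 6 k chi psi isT hchi hpsi 0 (-1) 1 erefl.
have u3 : unramified 6 chi psi (mx2 3 (-2) 6 (- 3)).
  have g3 := @Gamma0plus_type_m 6 3 1 (-2) 1 (-1) isT erefl.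
  apply: (unramified_cancelr hchi hpsi g3 u2); rewrite mx2M.
  exact: (@unramified_type_N R 6 k chi psi isT hchi hpsi (-3) (-7) (-5) (-2) erefl).
have e3 := elliptic_involution (isT : 3 * 3 + (-2) * 6 != 0 :> int) u3.
by apply: elliptic_eq (EllipticM (EllipticM e3 e1) e2) _; rewrite !mx2M; congr mx2; ring.
Qed.

Lemma translation_elliptic14 : translation_elliptic k chi psi 14.
Proof.
move=> hchi hpsi; exists 98 => //.
have [_ _ _ _ /(_ isT) chi1] := hchi; have [_ _ _ psi2 _] := hpsi.
(* This matrix is hyperbolic and is no factor of the translation; it serves to evaluate the
   characters on matrices of type W_7. *)
have w2 : AtkinLehner 14 2 (mx2 4 1 14 4) by exists 2, 1, 1, 2.
have u2 : unramified 14 chi psi (mx2 4 1 14 4).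
  apply: (@unramified_sqr R 14 k chi psi isT hchi _ (mx2 15 4 56 15) 2) => //.
  - exact: (Gamma0plus_AL (m := 2)).
  - exact: Gamma0_mx2.
  - by rewrite !mx2M.
  (* The lower right entry 15 is 1 modulo 7, a square. *)
  - case: chi1 => [->//|[_ ->//]|[]//]; rewrite /legendre /=.
    by case: existsP => // -[]; exists 1.
  - by apply: psi2 w2; right.
have unr7 (a b c d : int) : 7 * a * (7 * d) - b * (14 * c) = 7 ->
    unramified 14 chi psi (mx2 (7 * a) b (14 * c) (7 * d)).
  move=> det7; have g7 := @Gamma0plus_type_m 14 7 a b c d isT det7.
  apply: (unramified_cancelr hchi hpsi g7 u2); rewrite mx2M.
  have -> : 7%:Z * a * 4 + b * 14 = 14%:Z * (2 * a + b) by ring.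
  have -> : 14%:Z * c * 4 + 7%:Z * d * 14 = 14%:Z * (4 * c + 7 * d) by ring.
  have -> : 14%:Z * c * 1 + 7%:Z * d * 4 = 14%:Z * (c + 2 * d) by ring.
  apply: (unramified_type_N _ hchi hpsi) => //; lia.
have e1 := elliptic_involution (isT : 7 * 7 + (-4) * 14 != 0 :> int) (unr7 1 (-4) 1 (-1) erefl).
have e2 := @elliptic_Fricke_type R 14 k chi psi isT hchi hpsi 0 (-1) 1 erefl.
have e3 := elliptic_involution (isT : 7 * 7 + 2 * (-28) != 0 :> int) (unr7 1 2 (-2) (-1) erefl).
have e4 := @elliptic_Fricke_type R 14 k chi psi isT hchi hpsi (-1) (-5) 3 erefl.
by apply: elliptic_eq (EllipticM (EllipticM e1 e2) (EllipticM e3 e4)) _;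
  rewrite !mx2M; congr mx2; ring.
Qed.

Lemma translation_elliptic15 : translation_elliptic k chi psi 15.
Proof.
move=> hchi hpsi; exists (- 75); first by rewrite oppr_eq0.
have [_ _ _ _ /(_ isT) chi1] := hchi; have [_ _ _ _ psi3] := hpsi.
(* Again a hyperbolic auxiliary matrix, here for the type W_5. *)
have w3 : AtkinLehner 15 3 (mx2 6 1 15 3) by exists 2, 1, 1, 1.
have u3 : unramified 15 chi psi (mx2 6 1 15 3).
  apply: (@unramified_sqr R 15 k chi psi isT hchi _ (mx2 17 3 45 8) 3) => //.
  - exact: (Gamma0plus_AL (m := 3)).
  - exact: Gamma0_mx2.
  - by rewrite !mx2M.
  - case: chi1 => [->//|[]//|[_ ->//]].
    (* The entry 8 is a non-residue modulo 3 and modulo 5, so the two signs cancel. *)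
    have -> : kronecker 8 15 = legendre 8 3 * legendre 8 5.
      have p15 : primes 15 = [:: 3; 5]%N by vm_compute.
      have l3 : logn 3 15 = 1%N by vm_compute.
      have l5 : logn 5 15 = 1%N by vm_compute.
      rewrite -[15]/(15%N%:Z) kronecker_posE// p15 !big_cons big_nil l3 l5.
      by rewrite !expr1 mulr1.
    rewrite /legendre /=.
    have -> : [exists x : 'I_3, (3 %| x%:Z ^+ 2 - 8)%Z] = false.
      by apply/negbTE/existsPn => -[[|[|[|]]]].
    have -> : [exists x : 'I_5, (5 %| x%:Z ^+ 2 - 8)%Z] = false.
      by apply/negbTE/existsPn => -[[|[|[|[|[|]]]]]].
    by [].
  - exact: psi3 w3.
have unr5 (a b c d : int) : 5 * a * (5 * d) - b * (15 * c) = 5 ->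
    unramified 15 chi psi (mx2 (5 * a) b (15 * c) (5 * d)).
  move=> det5; have g5 := @Gamma0plus_type_m 15 5 a b c d isT det5.
  apply: (unramified_cancelr hchi hpsi g5 u3); rewrite mx2M.
  have -> : 5%:Z * a * 6 + b * 15 = 15%:Z * (2 * a + b) by ring.
  have -> : 15%:Z * c * 6 + 5%:Z * d * 15 = 15%:Z * (6 * c + 5 * d) by ring.
  have -> : 15%:Z * c * 1 + 5%:Z * d * 3 = 15%:Z * (c + d) by ring.
  apply: (unramified_type_N _ hchi hpsi) => //; lia.
have e1 := @elliptic_Fricke_type R 15 k chi psi isT hchi hpsi 1 (-8) 2 erefl.
have e2 := elliptic_involution (isT : 5 * 5 + (-2) * 15 != 0 :> int) (unr5 1 (-2) 1 (-1) erefl).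
have e3 := @elliptic_Fricke_type R 15 k chi psi isT hchi hpsi 0 (-1) 1 erefl.
have e4 := elliptic_involution (isT : (-5) * (-5) + (-2) * 15 != 0 :> int) (unr5 (-1) (-2) 1 1 erefl).
by apply: elliptic_eq (EllipticM (EllipticM e1 e2) (EllipticM e3 e4)) _;
  rewrite !mx2M; congr mx2; ring.
Qed.

End CompositeLevels.

(** * Vanishing of the constant term *)

Section Periods.
Variables (R : realType) (F G : R[i] -> R[i]).
Hypothesis dG : forall tau, upper_half tau -> qdiff G tau (F tau).

Definition period_free (g : 'M[rat]_2) := 0 < \det g /\
  forall tau, upper_half tau -> G (moebius g tau) = G tau.

Lemma period_freeM g h : period_free g -> period_free h -> period_free (g *m h).
Proof.
move=> [dg hg] [dh hh]; split=> [|tau tauH]; first by rewrite det_mulmx mulr_gt0.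
by rewrite moebiusM// hg ?hh//; exact: moebius_upper_half.
Qed.

Lemma torsion_period_free g (r : nat) (s : rat) : 0 < \det g -> invariant2 F g ->
  (0 < r)%N -> s != 0 -> g ^+ r = s%:M -> period_free g.
Proof.
move=> dg Fg r0 s0 gr; split=> // tau tauH.
have [x hx] := primitive_period dG dg Fg.
have hpow (n : nat) : 0 < \det (g ^+ n) /\
    forall t, upper_half t -> G (moebius (g ^+ n) t) = G t + x *+ n.
  elim: n => [|n [dn IH]].
    by rewrite expr0 det1; split=> // t tH; rewrite moebius_scalar ?oner_eq0// mulr0n addr0.
  rewrite exprS -mulmxE det_mulmx mulr_gt0//; split=> // t tH.
  rewrite moebiusM// hx; last exact: moebius_upper_half.
  by rewrite IH// mulrSr addrA.
have [_ /(_ _ tauH)] := hpow r; rewrite gr moebius_scalar// => /eqP.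
rewrite -subr_eq0 opprD addNKr oppr_eq0 mulrn_eq0 eqn0Ngt r0 /= => /eqP x0.
by rewrite hx// x0 addr0.
Qed.

End Periods.

Lemma translation_elliptic_levels (R : realType) (k : int) (chi psi : 'M[rat]_2 -> R[i])
    (N : nat) : N \in levels -> translation_elliptic k chi psi N.
Proof.
rewrite !inE => /or4P[||| /or4P[||| /orP[|/orP[|]]]] /eqP ->.
- exact: translation_elliptic2.
- exact: translation_elliptic3.
- exact: translation_elliptic5.
- exact: translation_elliptic6.
- exact: translation_elliptic7.
- exact: translation_elliptic11.
- exact: translation_elliptic14.
- exact: translation_elliptic15.
- exact: translation_elliptic23.
Qed.

Lemma weight2_constant_term (R : realType) (N : nat) (k : int)
    (chi psi : 'M[rat]_2 -> R[i]) (f g : R[i] -> R[i]) (c : int -> R[i]) :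
  N \in levels -> admissible N k chi -> is_psi_pow N (- (2 * k)) psi ->
  transforms N k chi f -> transforms N (2 - k) (charM chi psi) g ->
  qexpansion (fun tau => f tau * g tau) c -> c 0 = 0.
Proof.
move=> hN hchi hpsi fT gT /qexpansion_primitive[G [dG GT]].
have N0 : (0 < N)%N by case: N hN {hchi hpsi fT gT}.
have [s s0 hs] := translation_elliptic_levels hN hchi hpsi.
have : period_free G (mx2 s s 0 s).
  elim: hs => [h r t [hh h1] r0 t0 hr|h h' _ hh _ hh'].
    2: exact: period_freeM.
  have dh := det_Gamma0plus N0 hh.
  apply: (torsion_period_free dG dh _ r0 _ hr); last by rewrite intr_eq0.
  (* The weights add up to 2 and [h1] cancels the two characters, so f g is invariant under h. *)
  move=> tau tauH; have -> : 2 = k + (2 - k) by rewrite addrC subrK.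
  by rewrite -slashM// fT// gT// mulrACA h1 mul1r.
have iH : upper_half (0 +i* 1 : R[i]) by rewrite /upper_half /= ltr01.
move=> [_ /(_ _ iH)].
have -> : moebius (mx2 s s 0 s) (0 +i* 1) = (0 +i* 1) + 1 :> R[i].
  rewrite /moebius !mxE /= rmorph0 mul0r add0r rmorph_int.
  by field; rewrite intr_eq0.
by rewrite GT => /eqP; rewrite -subr_eq0 addrC addKr => /eqP.
Qed.

(* f and g are f_{k,m}^{(chi)} and f_{2-k,n}^{(chi psi^{-2k})}; the integer
   corresponding to l for the second pair is -1 - l. *)
Theorem corollary10 (R : realType) (N : nat) (k : int)
    (chi psi_m2k : 'M[rat]_2 -> R[i]) (k' : nat) (l m n : int)
    (f g : R[i] -> R[i]) (a b : int -> R[i]) :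
  N \in levels ->
  admissible N k chi ->
  is_psi_pow N (- (2 * k)) psi_m2k ->
  is_kprime N chi k k' ->
  k = k'%:Z + l * (k1 N)%:Z ->
  - l <= m ->
  l + 1 <= n ->
  basis_form N k chi l m f a ->
  basis_form N (2 - k) (charM chi psi_m2k) (- 1 - l) n g b ->
  a n = - b m.
Proof.
move=> hN hchi hpsi _ _ lm ln [[_ fT _] fq am a0] [[_ gT _] gq bn b0].
have [c [M [M' [cq aM bM c0]]]] := qexpansionM fq gq.
have := weight2_constant_term hN hchi hpsi fT gT cq; rewrite c0 => sum0.
(* The gaps of the two forms are complementary: for i <= l the coefficient of f vanishes, and for i
   > l one has -i <= -1 - l, where that of g vanishes. *)
have other i : i != - m -> i != n -> a i * b (- i) = 0.
  move=> im i_n; have [il|il] := leP i l; first by rewrite a0 ?mul0r.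
  by rewrite b0 ?mulr0 ?eqr_opp//; lia.
have nm : n != - m by lia.
have window i : a i * b (- i) != 0 -> - M%:Z <= i <= M'%:Z.
  move=> ab0; apply/andP; split.
    by apply: contraNT ab0; rewrite -ltNge => /aM ->; rewrite mul0r.
  by apply: contraNT ab0; rewrite -ltNge => h; rewrite bM ?mulr0// ltrN2.
(* The exponent j may lie outside the range of summation; by [window] both sides are then 0, so n
   and -m need no comparison with M and M'. *)
have pick (j : int) : \sum_(i < (M + M').+1)
    (if i%:Z - M%:Z == j then a j * b (- j) else 0) = a j * b (- j).
  have [jw|jw] := boolP (- M%:Z <= j <= M'%:Z); last first.
    have -> : a j * b (- j) = 0 by apply/eqP; apply: contraNT jw; exact: window.
    by rewrite big1// => i _; case: ifP.
  have jlt : (absz (j + M%:Z)%R < (M + M').+1)%N by lia.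
  rewrite -big_mkcond /= (big_pred1 (Ordinal jlt))// => i /=.
  apply/eqP/eqP => [ij|->] /=; last by lia.
  by apply/val_inj => /=; lia.
have : a n * b (- n) + a (- m) * b m = 0.
  rewrite -[RHS]sum0 -(pick n) -[a (- m) * b m]/(a (- m) * b m).
  have := pick (- m); rewrite opprK => <-.
  rewrite -big_split /=; apply: eq_bigr => i _; rewrite -[M%:Z - _]opprB.
  have [->|i_n] := eqVneq (i%:Z - M%:Z) n; first by rewrite (negPf nm) addr0.
  by rewrite add0r; case: eqVneq => [->|im]; rewrite ?opprK// other.
by rewrite bn am mulr1 mul1r => /eqP; rewrite addr_eq0 => /eqP.
Qed.
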